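(* Let $\mathcal{C}$ be a modular tensor category with braiding $\sigma$, and let $g\in\mathcal{C}$ be an invertible object of order $M=|g|$. Let $q$ be defined by $\sigma_{g,g}=q\,\mathrm{id}_{g\otimes g}$, put $A:=M/|q^2|$ (where $|q^2|$ is the multiplicative order of $q^2$), assume $A+1$ is coprime to $M$, and fix a primitive $M$-th root of unity $\zeta_M$ with $\zeta_M^A=q^2$. Let $K$ be a positive integer such that $$(A+1)^K\equiv1\pmod{A\cdot M}.$$ Then $$\mathcal{F}_{(g,\zeta_M)}^{K}\cong\mathrm{Id}_{\mathcal{C}}$$ as monoidal auto-equivalences of $\mathcal{C}$, where $\mathcal{F}_{(g,\zeta_M)}$ is the simple current auto-equivalence defined in the context and $\mathcal{F}_{(g,\zeta_M)}^{K}$ is its $K$-fold composite.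
   Context: All categories are over $\mathbb{C}$; associators of $\mathcal{C}$ are suppressed. A modular tensor category is a pivotal braided fusion category whose symmetric centre $\{X:\sigma_{X,Y}\circ\sigma_{Y,X}=\mathrm{id}\text{ for all }Y\}$ is trivial. **Simple current auto-equivalences.** Let $g$ be an invertible object of order $M$ (minimal $M\ge1$ with $g^{\otimes M}\cong\mathbf 1$). Then $\sigma_{g,g}=q\,\mathrm{id}_{g\otimes g}$ for a scalar $q$ with $q^2$ an $M$-th root of unity. Put $A:=M/|q^2|$, assume $A+1$ is coprime to $M$ (which implies $q^M=1$), and fix a primitive $M$-th root of unity $\zeta_M$ with $\zeta_M^A=q^2$. For $m\in\mathbb{Z}/M\mathbb{Z}$ let $\mathcal{C}_m$ be the full abelian subcategory of objects $X$ for which the double braiding $\sigma_{g,X}\circ\sigma_{X,g}$ equals $\zeta_M^m$ times the identity; then $\mathcal{C}=\bigoplus_{m}\mathcal{C}_m$ is a $\mathbb{Z}/M\mathbb{Z}$-grading. Represent classes by $0,\dots,M-1$ and put $g^m:=g^{\otimes m}$. Define $\mathcal{F}_{(g,\zeta_M)}(X_m):=g^m\otimes X_m$ for $X_m\in\mathcal{C}_m$ (and $f\mapsto\mathrm{id}_{g^m}\otimes f$ on morphisms of $\mathcal{C}_m$), extended additively. Choose basis elements $v_{m,n}$ of $\mathrm{Hom}(g^m\otimes g^n,g^{m+n})$ (indices mod $M$) with $$v_{m+n,p}\circ(v_{m,n}\otimes\mathrm{id}_{g^p})=v_{m,n+p}\circ(\mathrm{id}_{g^m}\otimes v_{n,p}),\qquad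 v_{n,m}\circ\sigma_{g^m,g^n}=q^{mn}v_{m,n}$$ for all $m,n,p$ (this is possible). With the structure maps $$\tau_{X_m,Y_n}:=(v_{m,n}\otimes\mathrm{id}_{X_m\otimes Y_n})\circ(\mathrm{id}_{g^m}\otimes\sigma_{X_m,g^n}\otimes\mathrm{id}_{Y_n}):\mathcal{F}_{(g,\zeta_M)}(X_m)\otimes\mathcal{F}_{(g,\zeta_M)}(Y_n)\to\mathcal{F}_{(g,\zeta_M)}(X_m\otimes Y_n),$$ $\mathcal{F}_{(g,\zeta_M)}$ is a monoidal auto-equivalence of $\mathcal{C}$. Composites of monoidal functors carry the composite monoidal structure, and $\cong$ means existence of a monoidal natural isomorphism. *)

(* Defs.v *)
From mathcomp Require Import all_boot all_order all_algebra.
From mathcomp Require Import reals complex.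

Set Implicit Arguments.
Unset Strict Implicit.
Unset Printing Implicit Defensive.
Import GRing.Theory.
Local Open Scope ring_scope.

Record linear_category (k : fieldType) := LinearCategory {
  obj :> Type;
  hom : obj -> obj -> vectType k;
  idm : forall X : obj, hom X X;
  comp : forall X Y Z : obj, hom Y Z -> hom X Y -> hom X Z;
  comp1m : forall (X Y : obj) (f : hom X Y), comp (idm Y) f = f;
  compm1 : forall (X Y : obj) (f : hom X Y), comp f (idm X) = f;
  compA : forall (X Y Z W : obj) (h : hom Z W) (g : hom Y Z) (f : hom X Y),
    comp h (comp g f) = comp (comp h g) f;
  comp_linl : forall (X Y Z : obj) (a : k) (g g' : hom Y Z) (f : hom X Y),
    comp (a *: g + g') f = a *: comp g f + comp g' f;
  comp_linr : forall (X Y Z : obj) (a : k) (g : hom Y Z) (f f' : hom X Y),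
    comp g (a *: f + f') = a *: comp g f + comp g f' }.

Arguments hom {k l} X Y : rename.
Arguments idm {k l} X : rename.
Arguments comp {k l X Y Z} g f : rename.

Declare Scope cat_scope.
Delimit Scope cat_scope with cat.
Local Open Scope cat_scope.
Notation "g ∘ f" := (comp g f) (at level 45, left associativity) : cat_scope.

Section Category.
Variables (k : fieldType) (C : linear_category k).

Definition is_iso (X Y : C) (f : hom X Y) : Prop :=
  exists g : hom Y X, g ∘ f = idm X /\ f ∘ g = idm Y.

Definition isomorphic (X Y : C) : Prop := exists f : hom X Y, is_iso f.

(* the identity morphism between two propositionally equal objects *)
Definition idcast (X Y : C) (e : X = Y) : hom X Y :=
  match e in _ = Z return hom X Z with erefl => idm X end.

Definition is_zero (X : C) : Prop := idm X = 0.

Definition is_mono (X Y : C) (f : hom X Y) : Prop :=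
  forall (W : C) (u v : hom W X), f ∘ u = f ∘ v -> u = v.

Definition is_epi (X Y : C) (f : hom X Y) : Prop :=
  forall (W : C) (u v : hom Y W), u ∘ f = v ∘ f -> u = v.

Definition is_kernel (K X Y : C) (f : hom X Y) (i : hom K X) : Prop :=
  f ∘ i = 0 /\
  forall (W : C) (h : hom W X), f ∘ h = 0 -> exists! u : hom W K, i ∘ u = h.

Definition is_cokernel (X Y Q : C) (f : hom X Y) (p : hom Y Q) : Prop :=
  p ∘ f = 0 /\
  forall (W : C) (h : hom Y W), h ∘ f = 0 -> exists! u : hom Q W, u ∘ p = h.

Definition is_biproduct (I : finType) (S : C) (Y : I -> C)
    (inc : forall i, hom (Y i) S) (prj : forall i, hom S (Y i)) : Prop :=
  [/\ forall i, prj i ∘ inc i = idm (Y i),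
      forall i j, i != j -> prj j ∘ inc i = 0
    & \sum_i (inc i ∘ prj i) = idm S].

Definition is_direct_sum (I : finType) (S : C) (Y : I -> C) : Prop :=
  exists (inc : forall i, hom (Y i) S) (prj : forall i, hom S (Y i)),
    is_biproduct inc prj.

Definition is_simple (X : C) : Prop :=
  ~ is_zero X /\
  forall (W : C) (i : hom W X), is_mono i -> is_zero W \/ is_iso i.

(* The case n = 0 of [ab_sum] is the existence of a zero object. *)
Record is_abelian : Prop := IsAbelian {
  ab_sum : forall (n : nat) (Y : 'I_n -> C), exists S : C, is_direct_sum S Y;
  ab_ker : forall (X Y : C) (f : hom X Y),
    exists (K : C) (i : hom K X), is_kernel f i;
  ab_coker : forall (X Y : C) (f : hom X Y),
    exists (Q : C) (p : hom Y Q), is_cokernel f p;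
  ab_monic : forall (X Y : C) (f : hom X Y), is_mono f ->
    exists (Z : C) (h : hom Y Z), is_kernel h f;
  ab_epic : forall (X Y : C) (f : hom X Y), is_epi f ->
    exists (Z : C) (h : hom Z X), is_cokernel h f }.

Definition is_semisimple : Prop :=
  forall X : C, exists (n : nat) (Y : 'I_n -> C),
    (forall i, is_simple (Y i)) /\ is_direct_sum X Y.

Definition has_finitely_many_simples : Prop :=
  exists (n : nat) (Y : 'I_n -> C),
    forall X : C, is_simple X -> exists i, isomorphic X (Y i).

End Category.

Record monoidal_category (k : fieldType) := MonoidalCategory {
  mc_cat :> linear_category k;
  tens : mc_cat -> mc_cat -> mc_cat;
  munit : mc_cat;
  tensm : forall X X' Y Y' : mc_cat,
    hom X X' -> hom Y Y' -> hom (tens X Y) (tens X' Y');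
  assoc : forall X Y Z : mc_cat,
    hom (tens (tens X Y) Z) (tens X (tens Y Z));
  assocV : forall X Y Z : mc_cat,
    hom (tens X (tens Y Z)) (tens (tens X Y) Z);
  lunit : forall X : mc_cat, hom (tens munit X) X;
  lunitV : forall X : mc_cat, hom X (tens munit X);
  runit : forall X : mc_cat, hom (tens X munit) X;
  runitV : forall X : mc_cat, hom X (tens X munit);
  tensm1 : forall X Y : mc_cat, tensm (idm X) (idm Y) = idm (tens X Y);
  tensm_comp : forall (X X' X'' Y Y' Y'' : mc_cat)
      (f' : hom X' X'') (f : hom X X') (g' : hom Y' Y'') (g : hom Y Y'),
    tensm (f' ∘ f) (g' ∘ g) = tensm f' g' ∘ tensm f g;
  tensm_linl : forall (X X' Y Y' : mc_cat) (a : k)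
      (f f' : hom X X') (g : hom Y Y'),
    tensm (a *: f + f') g = a *: tensm f g + tensm f' g;
  tensm_linr : forall (X X' Y Y' : mc_cat) (a : k)
      (f : hom X X') (g g' : hom Y Y'),
    tensm f (a *: g + g') = a *: tensm f g + tensm f g';
  assocK : forall X Y Z : mc_cat,
    assocV X Y Z ∘ assoc X Y Z = idm (tens (tens X Y) Z);
  assocVK : forall X Y Z : mc_cat,
    assoc X Y Z ∘ assocV X Y Z = idm (tens X (tens Y Z));
  lunitK : forall X : mc_cat, lunitV X ∘ lunit X = idm (tens munit X);
  lunitVK : forall X : mc_cat, lunit X ∘ lunitV X = idm X;
  runitK : forall X : mc_cat, runitV X ∘ runit X = idm (tens X munit);
  runitVK : forall X : mc_cat, runit X ∘ runitV X = idm X;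
  assoc_nat : forall (X X' Y Y' Z Z' : mc_cat)
      (f : hom X X') (g : hom Y Y') (h : hom Z Z'),
    assoc X' Y' Z' ∘ tensm (tensm f g) h =
    tensm f (tensm g h) ∘ assoc X Y Z;
  lunit_nat : forall (X Y : mc_cat) (f : hom X Y),
    lunit Y ∘ tensm (idm munit) f = f ∘ lunit X;
  runit_nat : forall (X Y : mc_cat) (f : hom X Y),
    runit Y ∘ tensm f (idm munit) = f ∘ runit X;
  pentagon : forall X Y Z W : mc_cat,
    tensm (idm X) (assoc Y Z W) ∘ assoc X (tens Y Z) W
      ∘ tensm (assoc X Y Z) (idm W) =
    assoc X Y (tens Z W) ∘ assoc (tens X Y) Z W;
  triangle : forall X Y : mc_cat,
    tensm (idm X) (lunit Y) ∘ assoc X munit Y = tensm (runit X) (idm Y) }.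

Arguments tens {k m} X Y : rename.
Arguments munit {k m} : rename.
Arguments tensm {k m X X' Y Y'} f g : rename.
Arguments assoc {k m} X Y Z : rename.
Arguments assocV {k m} X Y Z : rename.
Arguments lunit {k m} X : rename.
Arguments lunitV {k m} X : rename.
Arguments runit {k m} X : rename.
Arguments runitV {k m} X : rename.

Notation "X ⊗ Y" := (tens X Y) (at level 40, left associativity) : cat_scope.
Notation "f ⊠ g" := (tensm f g) (at level 40, left associativity) : cat_scope.

Section Monoidal.
Variables (k : fieldType) (C : monoidal_category k).

Definition invertible (g : C) : Prop :=
  exists h : C, isomorphic (g ⊗ h) munit /\ isomorphic (h ⊗ g) munit.

Fixpoint tpow (g : C) (n : nat) : C :=
  if n is n'.+1 then tpow g n' ⊗ g else munit.

Definition has_tensor_order (g : C) (M : nat) : Prop :=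
  [/\ (0 < M)%N, isomorphic (tpow g M) munit
    & forall n, (0 < n < M)%N -> ~ isomorphic (tpow g n) munit].

Record rigid_structure := RigidStructure {
  ldual : C -> C;
  ev : forall X : C, hom (ldual X ⊗ X) munit;
  coev : forall X : C, hom munit (X ⊗ ldual X);
  ev_coev : forall X : C,
    runit X ∘ (idm X ⊠ ev X) ∘ assoc X (ldual X) X
      ∘ (coev X ⊠ idm X) ∘ lunitV X = idm X;
  coev_ev : forall X : C,
    lunit (ldual X) ∘ (ev X ⊠ idm (ldual X))
      ∘ assocV (ldual X) X (ldual X)
      ∘ (idm (ldual X) ⊠ coev X) ∘ runitV (ldual X) = idm (ldual X);
  rdual : C -> C;
  evr : forall X : C, hom (X ⊗ rdual X) munit;
  coevr : forall X : C, hom munit (rdual X ⊗ X);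
  evr_coevr : forall X : C,
    lunit X ∘ (evr X ⊠ idm X) ∘ assocV X (rdual X) X
      ∘ (idm X ⊠ coevr X) ∘ runitV X = idm X;
  coevr_evr : forall X : C,
    runit (rdual X) ∘ (idm (rdual X) ⊠ evr X)
      ∘ assoc (rdual X) X (rdual X)
      ∘ (coevr X ⊠ idm (rdual X)) ∘ lunitV (rdual X) = idm (rdual X) }.

(* Fusion categories, as in Etingof--Gelaki--Nikshych--Ostrik. *)
Record fusion_structure := FusionStructure {
  fus_abelian : is_abelian C;
  fus_semisimple : is_semisimple C;
  fus_finite : has_finitely_many_simples C;
  fus_unit : is_simple (munit : C);
  fus_rigid : rigid_structure }.

Section Pivotal.
Variable D : rigid_structure.

(* the morphism W -> Z^* corresponding to a pairing W ⊗ Z -> 1 *)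
Definition mate (W Z : C) (phi : hom (W ⊗ Z) munit) : hom W (ldual D Z) :=
  lunit (ldual D Z) ∘ (phi ⊠ idm (ldual D Z)) ∘ assocV W Z (ldual D Z)
    ∘ (idm W ⊠ coev D Z) ∘ runitV W.

Definition dualm (X Y : C) (f : hom X Y) : hom (ldual D Y) (ldual D X) :=
  mate (ev D Y ∘ (idm (ldual D Y) ⊠ f)).

(* the canonical isomorphism Y^* ⊗ X^* -> (X ⊗ Y)^* *)
Definition dual_tens (X Y : C) :
    hom (ldual D Y ⊗ ldual D X) (ldual D (X ⊗ Y)) :=
  mate (ev D Y
    ∘ (idm (ldual D Y) ⊠ (lunit Y ∘ (ev D X ⊠ idm Y) ∘ assocV (ldual D X) X Y))
    ∘ assoc (ldual D Y) (ldual D X) (X ⊗ Y)).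

(* A monoidal natural isomorphism from the identity functor to the double
   dual functor; [piv_tens] is the equation
   piv (X ⊗ Y) = (X^** ⊗ Y^** -> (X ⊗ Y)^** ) ∘ (piv X ⊠ piv Y)
   composed with the isomorphism (X ⊗ Y)^** -> (Y^* ⊗ X^* )^*. *)
Record pivotal_structure := PivotalStructure {
  piv : forall X : C, hom X (ldual D (ldual D X));
  piv_iso : forall X : C, is_iso (piv X);
  piv_nat : forall (X Y : C) (f : hom X Y),
    piv Y ∘ f = dualm (dualm f) ∘ piv X;
  piv_tens : forall X Y : C,
    dualm (dual_tens X Y) ∘ piv (X ⊗ Y) =
    dual_tens (ldual D Y) (ldual D X) ∘ (piv X ⊠ piv Y) }.

End Pivotal.
End Monoidal.

Record braided_category (k : fieldType) := BraidedCategory {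
  bc_cat :> monoidal_category k;
  braid : forall X Y : bc_cat, hom (X ⊗ Y) (Y ⊗ X);
  braidV : forall X Y : bc_cat, hom (Y ⊗ X) (X ⊗ Y);
  braidK : forall X Y : bc_cat, braidV X Y ∘ braid X Y = idm (X ⊗ Y);
  braidVK : forall X Y : bc_cat, braid X Y ∘ braidV X Y = idm (Y ⊗ X);
  braid_nat : forall (X X' Y Y' : bc_cat) (f : hom X X') (g : hom Y Y'),
    braid X' Y' ∘ (f ⊠ g) = (g ⊠ f) ∘ braid X Y;
  hexagon_r : forall X Y Z : bc_cat,
    assoc Y Z X ∘ braid X (Y ⊗ Z) ∘ assoc X Y Z =
    (idm Y ⊠ braid X Z) ∘ assoc Y X Z ∘ (braid X Y ⊠ idm Z);
  hexagon_l : forall X Y Z : bc_cat,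
    assocV Z X Y ∘ braid (X ⊗ Y) Z ∘ assocV X Y Z =
    (braid X Z ⊠ idm Y) ∘ assocV X Z Y ∘ (idm X ⊠ braid Y Z) }.

Arguments braid {k b} X Y : rename.
Arguments braidV {k b} X Y : rename.

Definition transparent (k : fieldType) (C : braided_category k) (X : C) : Prop :=
  forall Y : C, braid X Y ∘ braid Y X = idm (Y ⊗ X).

(* [mtc_modular]: the symmetric centre consists of the finite direct sums
   of copies of the unit object. *)
Record modular_category (k : fieldType) := ModularCategory {
  mtc_cat :> braided_category k;
  mtc_fusion : fusion_structure mtc_cat;
  mtc_pivotal : pivotal_structure (fus_rigid mtc_fusion);
  mtc_modular : forall X : mtc_cat, transparent X ->
    exists n : nat, is_direct_sum X (fun _ : 'I_n => (munit : mtc_cat)) }.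

(* Linear monoidal endofunctors, as in Etingof--Gelaki--Nikshych--Ostrik,
   Definition 2.4.1: the unit isomorphism is determined by the other data
   and is only required to exist. *)

Record monoidal_functor (k : fieldType) (C : monoidal_category k) :=
  MonoidalFunctor {
  mf_obj :> C -> C;
  mf_map : forall X Y : C, hom X Y -> hom (mf_obj X) (mf_obj Y);
  mf_tens : forall X Y : C, hom (mf_obj X ⊗ mf_obj Y) (mf_obj (X ⊗ Y));
  mf_id : forall X : C, mf_map (idm X) = idm (mf_obj X);
  mf_comp : forall (X Y Z : C) (g : hom Y Z) (f : hom X Y),
    mf_map (g ∘ f) = mf_map g ∘ mf_map f;
  mf_lin : forall (X Y : C) (a : k) (f g : hom X Y),
    mf_map (a *: f + g) = a *: mf_map f + mf_map g;
  mf_tens_nat : forall (X X' Y Y' : C) (f : hom X X') (g : hom Y Y'),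
    mf_tens X' Y' ∘ (mf_map f ⊠ mf_map g) = mf_map (f ⊠ g) ∘ mf_tens X Y;
  mf_tens_iso : forall X Y : C, is_iso (mf_tens X Y);
  mf_assoc : forall X Y Z : C,
    mf_map (assoc X Y Z) ∘ mf_tens (X ⊗ Y) Z ∘ (mf_tens X Y ⊠ idm (mf_obj Z)) =
    mf_tens X (Y ⊗ Z) ∘ (idm (mf_obj X) ⊠ mf_tens Y Z)
      ∘ assoc (mf_obj X) (mf_obj Y) (mf_obj Z);
  mf_unit : isomorphic (mf_obj munit) munit }.

Arguments mf_map {k C} F {X Y} f : rename.
Arguments mf_tens {k C} F X Y : rename.

Section MonoidalFunctors.
Variables (k : fieldType) (C : monoidal_category k).

Lemma isoM (X Y Z : C) (g : hom Y Z) (f : hom X Y) :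
  is_iso g -> is_iso f -> is_iso (g ∘ f).
Proof.
move=> [g' [g'g gg']] [f' [f'f ff']]; exists (f' ∘ g'); split.
  by rewrite compA -(compA f') g'g compm1.
by rewrite compA -(compA g) ff' compm1.
Qed.

Lemma iso1 (X : C) : is_iso (idm X).
Proof. by exists (idm X); rewrite comp1m. Qed.

Lemma isomorphic_refl (X : C) : isomorphic X X.
Proof. by exists (idm X); apply: iso1. Qed.

Lemma isomorphic_sym (X Y : C) : isomorphic X Y -> isomorphic Y X.
Proof. by move=> [f [g [gf fg]]]; exists g, f. Qed.

Lemma isomorphic_trans (X Y Z : C) :
  isomorphic X Y -> isomorphic Y Z -> isomorphic X Z.
Proof. by move=> [f fi] [g gi]; exists (g ∘ f); apply: isoM. Qed.

Lemma mf_iso (F : monoidal_functor C) (X Y : C) (f : hom X Y) :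
  is_iso f -> is_iso (mf_map F f).
Proof. by move=> [g [gf fg]]; exists (mf_map F g); rewrite -!mf_comp gf fg !mf_id. Qed.

Program Definition mf_one : monoidal_functor C :=
  {| mf_obj := fun X => X; mf_map := fun X Y f => f;
     mf_tens := fun X Y => idm (X ⊗ Y) |}.
Next Obligation. by rewrite comp1m compm1. Qed.
Next Obligation. exact: iso1. Qed.
Next Obligation. by rewrite !tensm1 !compm1 !comp1m. Qed.
Next Obligation. exact: isomorphic_refl. Qed.

Program Definition mf_compose (F G : monoidal_functor C) : monoidal_functor C :=
  {| mf_obj := fun X => F (G X);
     mf_map := fun X Y f => mf_map F (mf_map G f);
     mf_tens := fun X Y => mf_map F (mf_tens G X Y) ∘ mf_tens F (G X) (G Y) |}.
Next Obligation. by rewrite !mf_id. Qed.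
Next Obligation. by rewrite !mf_comp. Qed.
Next Obligation. by rewrite !mf_lin. Qed.
Next Obligation.
by rewrite -compA mf_tens_nat !compA -!mf_comp mf_tens_nat.
Qed.
Next Obligation.
by apply: isoM; [apply: mf_iso; exact: mf_tens_iso | exact: mf_tens_iso].
Qed.
Next Obligation.
have E1 : (mf_map F (mf_tens G X Y) ∘ mf_tens F (G X) (G Y)) ⊠ idm (F (G Z)) =
  (mf_map F (mf_tens G X Y) ⊠ mf_map F (idm (G Z)))
  ∘ (mf_tens F (G X) (G Y) ⊠ idm (F (G Z))).
  by rewrite -tensm_comp mf_id comp1m.
have E2 : idm (F (G X)) ⊠ (mf_map F (mf_tens G Y Z) ∘ mf_tens F (G Y) (G Z)) =
  (mf_map F (idm (G X)) ⊠ mf_map F (mf_tens G Y Z))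
  ∘ (idm (F (G X)) ⊠ mf_tens F (G Y) (G Z)).
  by rewrite -tensm_comp mf_id comp1m.
rewrite E1 E2 !compA.
rewrite -[_ ∘ mf_tens F (G (X ⊗ Y)) _ ∘ _]compA mf_tens_nat.
rewrite -[_ ∘ mf_tens F (G X) (G (Y ⊗ Z)) ∘ _]compA mf_tens_nat.
rewrite !compA -!mf_comp mf_assoc !mf_comp -!compA.
by congr (_ ∘ (_ ∘ _)); rewrite !compA mf_assoc.
Qed.
Next Obligation.
apply: (@isomorphic_trans _ (F munit)); last exact: mf_unit.
by have [f fi] := mf_unit G; exists (mf_map F f); apply: mf_iso.
Qed.

Fixpoint mf_iter (K : nat) (F : monoidal_functor C) : monoidal_functor C :=
  if K is K'.+1 then mf_compose F (mf_iter K' F) else mf_one.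

Definition monoidally_isomorphic (F G : monoidal_functor C) : Prop :=
  exists eta : forall X : C, hom (F X) (G X),
    [/\ forall X, is_iso (eta X),
        forall (X Y : C) (f : hom X Y),
          eta Y ∘ mf_map F f = mf_map G f ∘ eta X
      & forall X Y : C,
          eta (X ⊗ Y) ∘ mf_tens F X Y = mf_tens G X Y ∘ (eta X ⊠ eta Y)].

End MonoidalFunctors.

Section Linearity.
Variables (k : fieldType) (C : monoidal_category k).

Lemma compDl (X Y Z : C) (g g' : hom Y Z) (f : hom X Y) :
  (g + g') ∘ f = g ∘ f + g' ∘ f.
Proof. by rewrite -[g]scale1r comp_linl !scale1r. Qed.

Lemma compDr (X Y Z : C) (g : hom Y Z) (f f' : hom X Y) :
  g ∘ (f + f') = g ∘ f + g ∘ f'.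
Proof. by rewrite -[f]scale1r comp_linr !scale1r. Qed.

Lemma comp0l (X Y Z : C) (f : hom X Y) : (0 : hom Y Z) ∘ f = 0.
Proof. by apply: (addrI (0 ∘ f)); rewrite -compDl !addr0. Qed.

Lemma comp0r (X Y Z : C) (g : hom Y Z) : g ∘ (0 : hom X Y) = 0.
Proof. by apply: (addrI (g ∘ 0)); rewrite -compDr !addr0. Qed.

Lemma compZl (X Y Z : C) a (g : hom Y Z) (f : hom X Y) :
  (a *: g) ∘ f = a *: (g ∘ f).
Proof. by rewrite -[a *: g]addr0 comp_linl comp0l addr0. Qed.

Lemma compZr (X Y Z : C) a (g : hom Y Z) (f : hom X Y) :
  g ∘ (a *: f) = a *: (g ∘ f).
Proof. by rewrite -[a *: f]addr0 comp_linr comp0r addr0. Qed.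

Lemma comp_suml (I : finType) (P : pred I) (X Y Z : C) (G : I -> hom Y Z)
  (f : hom X Y) : (\sum_(i | P i) G i) ∘ f = \sum_(i | P i) (G i ∘ f).
Proof. by apply: (big_morph (fun x => x ∘ f)) => [x y|]; rewrite ?compDl ?comp0l. Qed.

Lemma comp_sumr (I : finType) (P : pred I) (X Y Z : C) (g : hom Y Z)
  (G : I -> hom X Y) : g ∘ (\sum_(i | P i) G i) = \sum_(i | P i) (g ∘ G i).
Proof. by apply: (big_morph (fun x => g ∘ x)) => [x y|]; rewrite ?compDr ?comp0r. Qed.

Lemma tensmDl (X X' Y Y' : C) (f f' : hom X X') (g : hom Y Y') :
  (f + f') ⊠ g = f ⊠ g + f' ⊠ g.
Proof. by rewrite -[f]scale1r tensm_linl !scale1r. Qed.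

Lemma tensmDr (X X' Y Y' : C) (f : hom X X') (g g' : hom Y Y') :
  f ⊠ (g + g') = f ⊠ g + f ⊠ g'.
Proof. by rewrite -[g]scale1r tensm_linr !scale1r. Qed.

Lemma tensm0l (X X' Y Y' : C) (g : hom Y Y') : (0 : hom X X') ⊠ g = 0.
Proof. by apply: (addrI (0 ⊠ g)); rewrite -tensmDl !addr0. Qed.

Lemma tensm0r (X X' Y Y' : C) (f : hom X X') : f ⊠ (0 : hom Y Y') = 0.
Proof. by apply: (addrI (f ⊠ 0)); rewrite -tensmDr !addr0. Qed.

Lemma tensmZl (X X' Y Y' : C) a (f : hom X X') (g : hom Y Y') :
  (a *: f) ⊠ g = a *: (f ⊠ g).
Proof. by rewrite -[a *: f]addr0 tensm_linl tensm0l addr0. Qed.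

Lemma tensmZr (X X' Y Y' : C) a (f : hom X X') (g : hom Y Y') :
  f ⊠ (a *: g) = a *: (f ⊠ g).
Proof. by rewrite -[a *: g]addr0 tensm_linr tensm0r addr0. Qed.

Lemma tensm_suml (I : finType) (P : pred I) (X X' Y Y' : C)
  (F : I -> hom X X') (g : hom Y Y') :
  (\sum_(i | P i) F i) ⊠ g = \sum_(i | P i) (F i ⊠ g).
Proof. by apply: (big_morph (fun x => x ⊠ g)) => [x y|]; rewrite ?tensmDl ?tensm0l. Qed.

Lemma tensm_sumr (I : finType) (P : pred I) (X X' Y Y' : C)
  (f : hom X X') (G : I -> hom Y Y') :
  f ⊠ (\sum_(i | P i) G i) = \sum_(i | P i) (f ⊠ G i).
Proof. by apply: (big_morph (fun x => f ⊠ x)) => [x y|]; rewrite ?tensmDr ?tensm0r. Qed.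

End Linearity.

Section Coherence.
Variables (k : fieldType) (C : monoidal_category k).

Lemma compE (W X Y Z : C) (f : hom X Y) (g : hom Y Z) (gf : hom X Z)
  (h : hom W X) : g ∘ f = gf -> g ∘ (f ∘ h) = gf ∘ h.
Proof. by move=> <-; rewrite compA. Qed.

Lemma iso_epi (X Y Z : C) (f : hom X Y) (u v : hom Y Z) :
  is_iso f -> u ∘ f = v ∘ f -> u = v.
Proof.
by move=> [g [_ fg]] e; rewrite -[u]compm1 -[v]compm1 -fg !compA e.
Qed.

Lemma iso_mono (X Y Z : C) (f : hom Y Z) (u v : hom X Y) :
  is_iso f -> f ∘ u = f ∘ v -> u = v.
Proof.
by move=> [g [gf _]] e; rewrite -[u]comp1m -[v]comp1m -gf -!compA e.
Qed.

Lemma tensm_1comp (X Y Y' Y'' : C) (f : hom Y' Y'') (g : hom Y Y') :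
  idm X ⊠ (f ∘ g) = (idm X ⊠ f) ∘ (idm X ⊠ g).
Proof. by rewrite -tensm_comp comp1m. Qed.

Lemma tensm_comp1 (X Y Y' Y'' : C) (f : hom Y' Y'') (g : hom Y Y') :
  (f ∘ g) ⊠ idm X = (f ⊠ idm X) ∘ (g ⊠ idm X).
Proof. by rewrite -tensm_comp comp1m. Qed.

Lemma iso_tensm (X X' Y Y' : C) (f : hom X X') (g : hom Y Y') :
  is_iso f -> is_iso g -> is_iso (f ⊠ g).
Proof.
move=> [f' [a b]] [g' [c d]]; exists (f' ⊠ g').
by rewrite -!tensm_comp a b c d !tensm1.
Qed.

Lemma iso_assoc (X Y Z : C) : is_iso (assoc X Y Z).
Proof. by exists (assocV X Y Z); rewrite assocK assocVK. Qed.

Lemma iso_assocV (X Y Z : C) : is_iso (assocV X Y Z).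
Proof. by exists (assoc X Y Z); rewrite assocK assocVK. Qed.

Lemma iso_lunit (X : C) : is_iso (lunit X).
Proof. by exists (lunitV X); rewrite lunitK lunitVK. Qed.

Lemma iso_runit (X : C) : is_iso (runit X).
Proof. by exists (runitV X); rewrite runitK runitVK. Qed.

Lemma assocV_nat (X X' Y Y' Z Z' : C)
  (f : hom X X') (g : hom Y Y') (h : hom Z Z') :
  assocV X' Y' Z' ∘ (f ⊠ (g ⊠ h)) = ((f ⊠ g) ⊠ h) ∘ assocV X Y Z.
Proof.
apply: (iso_mono (iso_assoc _ _ _)); rewrite !compA assocVK comp1m.
by rewrite assoc_nat -compA assocVK compm1.
Qed.

Lemma lunit_faithful (X Y : C) (f g : hom X Y) :
  idm munit ⊠ f = idm munit ⊠ g -> f = g.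
Proof. by move=> e; apply: (iso_epi (iso_lunit X)); rewrite -!lunit_nat e. Qed.

Lemma runit_faithful (X Y : C) (f g : hom X Y) :
  f ⊠ idm munit = g ⊠ idm munit -> f = g.
Proof. by move=> e; apply: (iso_epi (iso_runit X)); rewrite -!runit_nat e. Qed.

Lemma pentagon2 (X Y Z W : C) :
  assoc (X ⊗ Y) Z W ∘ (assocV X Y Z ⊠ idm W) =
  assocV X Y (Z ⊗ W) ∘ (idm X ⊠ assoc Y Z W) ∘ assoc X (Y ⊗ Z) W.
Proof.
apply: (iso_mono (iso_assoc _ _ _)); rewrite !compA assocVK comp1m -pentagon.
by rewrite -[LHS]compA -tensm_comp assocVK comp1m tensm1 compm1.
Qed.

Lemma pentagon3 (X Y Z W : C) :
  assoc X (Y ⊗ Z) W ∘ (assoc X Y Z ⊠ idm W) ∘ assocV (X ⊗ Y) Z W =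
  (idm X ⊠ assocV Y Z W) ∘ assoc X Y (Z ⊗ W).
Proof.
apply: (iso_mono (iso_tensm (iso1 X) (iso_assoc Y Z W))).
rewrite !compA pentagon -compA assocVK compm1.
by rewrite -tensm_comp assocVK comp1m tensm1 comp1m.
Qed.

Lemma tensm_1assocK (X Y Z W : C) :
  (idm X ⊠ assocV Y Z W) ∘ (idm X ⊠ assoc Y Z W) = idm (X ⊗ (Y ⊗ Z ⊗ W)).
Proof. by rewrite -tensm_1comp assocK tensm1. Qed.

Lemma lunit_tens (X Y : C) :
  lunit (X ⊗ Y) ∘ assoc munit X Y = lunit X ⊠ idm Y.
Proof.
apply: lunit_faithful.
apply: (iso_epi (iso_assoc munit (munit ⊗ X) Y)).
apply: (iso_epi (iso_tensm (iso_assoc munit munit X) (iso1 Y))).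
rewrite tensm_1comp -!compA (compA _ (assoc _ _ Y)) pentagon compA triangle.
rewrite -tensm1 -assoc_nat compA -assoc_nat -compA; congr (_ ∘ _).
by rewrite -tensm_comp triangle comp1m.
Qed.

Lemma runit_tens (X Y : C) :
  (idm X ⊠ runit Y) ∘ assoc X Y munit = runit (X ⊗ Y).
Proof.
apply: runit_faithful.
apply: (iso_mono (iso_assoc X Y munit)).
rewrite -triangle !compA -[in RHS]tensm1 assoc_nat -compA -pentagon.
rewrite !compA -tensm_comp triangle comp1m -assoc_nat -compA.
by rewrite -tensm_comp comp1m.
Qed.

End Coherence.

Section Braided.
Variables (k : fieldType) (C : braided_category k).

Lemma iso_braid (X Y : C) : is_iso (braid X Y).
Proof. by exists (braidV X Y); rewrite braidK braidVK. Qed.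

Lemma braid_tensr (X Y Z : C) :
  braid X (Y ⊗ Z) = assocV Y Z X ∘ (idm Y ⊠ braid X Z) ∘ assoc Y X Z
    ∘ (braid X Y ⊠ idm Z) ∘ assocV X Y Z.
Proof.
apply: (iso_mono (iso_assoc Y Z X)); apply: (iso_epi (iso_assoc X Y Z)).
by rewrite hexagon_r !compA assocVK comp1m -[RHS]compA assocK compm1.
Qed.

Lemma braid_tensl (X Y Z : C) :
  braid (X ⊗ Y) Z = assoc Z X Y ∘ (braid X Z ⊠ idm Y) ∘ assocV X Z Y
    ∘ (idm X ⊠ braid Y Z) ∘ assoc X Y Z.
Proof.
apply: (iso_mono (iso_assocV Z X Y)); apply: (iso_epi (iso_assocV X Y Z)).
by rewrite hexagon_l !compA assocK comp1m -[RHS]compA assocVK compm1.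
Qed.

Lemma lunit_braid (X : C) : lunit X ∘ braid X munit = runit X.
Proof.
apply: runit_faithful; apply: (iso_mono (iso_braid X munit)); apply: esym.
rewrite -triangle compA braid_nat -lunit_tens -!compA.
rewrite [assoc _ _ X ∘ _]compA hexagon_r -!compA compA lunit_nat -!compA.
by congr (_ ∘ _); rewrite compA lunit_tens tensm_comp1.
Qed.

Lemma runit_braid (X : C) : runit X ∘ braid munit X = lunit X.
Proof.
apply: lunit_faithful; apply: (iso_mono (iso_braid munit X)); apply: esym.
have e : idm munit ⊠ lunit X = (runit munit ⊠ idm X) ∘ assocV munit munit X.
  by rewrite -triangle -compA assocVK compm1.
have e2 : idm X ⊠ runit munit = runit (X ⊗ munit) ∘ assocV X munit munit.
  by rewrite -runit_tens -compA assocVK compm1.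
rewrite e compA braid_nat e2 -!compA.
rewrite [assocV X _ _ ∘ _]compA hexagon_l -!compA compA runit_nat -!compA.
congr (_ ∘ _); rewrite compA -runit_tens -(compA _ (assoc _ _ _)) assocVK compm1.
by rewrite tensm_1comp.
Qed.

Lemma double_braid1 (g : C) : braid g munit ∘ braid munit g = idm (munit ⊗ g).
Proof.
apply: (iso_mono (iso_lunit g)).
by rewrite compA lunit_braid runit_braid compm1.
Qed.

Lemma double_braid_tens (g X Y : C) :
  braid g (X ⊗ Y) ∘ braid (X ⊗ Y) g =
  assocV X Y g ∘ (idm X ⊠ braid g Y) ∘ assoc X g Y
    ∘ ((braid g X ∘ braid X g) ⊠ idm Y) ∘ assocV X g Y
    ∘ (idm X ⊠ braid Y g) ∘ assoc X Y g.
Proof.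
rewrite braid_tensl braid_tensr tensm_comp1 !compA.
by rewrite -[_ ∘ assocV g X Y ∘ assoc g X Y]compA assocK compm1.
Qed.

Fact swap_key : Datatypes.unit. Proof. exact: tt. Qed.

Definition swap (X B W : C) : hom (X ⊗ (B ⊗ W)) (B ⊗ (X ⊗ W)) :=
  locked_with swap_key
    (assoc B X W ∘ (braid X B ⊠ idm W) ∘ assocV X B W).

Lemma swapE (X B W : C) :
  swap X B W = assoc B X W ∘ (braid X B ⊠ idm W) ∘ assocV X B W.
Proof. by rewrite /swap unlock. Qed.

Lemma swap_nat (X X' B B' W W' : C) (x : hom X X') (b : hom B B')
  (w : hom W W') :
  swap X' B' W' ∘ (x ⊠ (b ⊠ w)) = (b ⊠ (x ⊠ w)) ∘ swap X B W.
Proof.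
rewrite !swapE !compA -assoc_nat -!compA assocV_nat; congr (_ ∘ _).
by rewrite !compA -!tensm_comp braid_nat comp1m compm1.
Qed.

Lemma iso_swap (X B W : C) : is_iso (swap X B W).
Proof.
rewrite swapE; apply: isoM; [apply: isoM|]; [exact: iso_assoc| |exact: iso_assocV].
by apply: iso_tensm; [exact: iso_braid | exact: iso1].
Qed.

Lemma swap_whisk (X B Y W : C) :
  (idm B ⊠ assoc X Y W) ∘ assoc B (X ⊗ Y) W ∘ (swap X B Y ⊠ idm W) =
  swap X B (Y ⊗ W) ∘ (idm X ⊠ assoc B Y W) ∘ assoc X (B ⊗ Y) W.
Proof.
rewrite !swapE !tensm_comp1 !compA pentagon.
rewrite -[_ ∘ assoc (B ⊗ X) Y W ∘ _]compA assoc_nat tensm1 -!compA.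
by congr (_ ∘ (_ ∘ _)); rewrite pentagon2 !compA.
Qed.

Lemma swap_tensr (X B D W : C) :
  assoc B D (X ⊗ W) ∘ swap X (B ⊗ D) W =
  (idm B ⊠ swap X D W) ∘ swap X B (D ⊗ W) ∘ (idm X ⊠ assoc B D W).
Proof.
apply: (iso_epi (iso_assoc X (B ⊗ D) W)).
apply: (iso_epi (iso_tensm (iso_assoc X B D) (iso1 W))).
transitivity ((idm B ⊠ swap X D W) ∘ swap X B (D ⊗ W)
  ∘ ((idm X ⊠ assoc B D W) ∘ assoc X (B ⊗ D) W ∘ (assoc X B D ⊠ idm W)));
  last by rewrite !compA.
rewrite pentagon !swapE !compA -[_ ∘ assocV X B (D ⊗ W) ∘ _]compA assocK compm1.
rewrite -[_ ∘ (braid X B ⊠ _) ∘ _]compA -[idm (D ⊗ W)]tensm1 -assoc_nat.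
rewrite !tensm_1comp !compA -[_ ∘ assoc B X (D ⊗ W) ∘ _]compA -pentagon.
rewrite -(pentagon B X D W) !compA.
rewrite -[_ ∘ (_ ⊠ assocV X D W) ∘ _]compA tensm_1assocK compm1.
rewrite -[_ ∘ assocV X (B ⊗ D) W ∘ _]compA assocK compm1.
rewrite -[_ ∘ assoc B (X ⊗ D) W]compA -assoc_nat.
rewrite -!compA -!tensm_comp1; congr (_ ∘ (_ ∘ _)).
by rewrite !compA hexagon_r.
Qed.

Lemma swap_tensl (X Y D W : C) :
  (idm D ⊠ assoc X Y W) ∘ swap (X ⊗ Y) D W =
  swap X D (Y ⊗ W) ∘ (idm X ⊠ swap Y D W) ∘ assoc X Y (D ⊗ W).
Proof.
rewrite !swapE braid_tensl !tensm_comp1 !compA pentagon.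
rewrite -[_ ∘ assoc (D ⊗ X) Y W ∘ _]compA assoc_nat tensm1 !compA.
rewrite -[_ ∘ assoc (X ⊗ D) Y W ∘ _]compA pentagon2 !compA.
rewrite -[_ ∘ assoc X (D ⊗ Y) W ∘ _]compA assoc_nat !compA.
rewrite !tensm_1comp -!compA; congr (_ ∘ (_ ∘ (_ ∘ (_ ∘ (_ ∘ _))))).
by rewrite compA pentagon3.
Qed.

(* id ⊗ braid X B ⊗ id, with the associators inserted *)
Definition exchange (A X B Y : C) :
    hom ((A ⊗ X) ⊗ (B ⊗ Y)) ((A ⊗ B) ⊗ (X ⊗ Y)) :=
  assocV A B (X ⊗ Y)
    ∘ (idm A ⊠ (assoc B X Y ∘ (braid X B ⊠ idm Y) ∘ assocV X B Y))
    ∘ assoc A X (B ⊗ Y).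

Lemma exchangeE (A X B Y : C) : exchange A X B Y =
  assocV A B (X ⊗ Y) ∘ (idm A ⊠ swap X B Y) ∘ assoc A X (B ⊗ Y).
Proof. by rewrite swapE. Qed.

Lemma exchange_nat (A A' X X' B B' Y Y' : C)
  (a : hom A A') (x : hom X X') (b : hom B B') (y : hom Y Y') :
  exchange A' X' B' Y' ∘ ((a ⊠ x) ⊠ (b ⊠ y)) =
  ((a ⊠ b) ⊠ (x ⊠ y)) ∘ exchange A X B Y.
Proof.
rewrite !exchangeE -!compA assoc_nat !compA -assocV_nat -!compA; congr (_ ∘ _).
by rewrite !compA -!tensm_comp swap_nat comp1m compm1.
Qed.

Lemma iso_exchange (A X B Y : C) : is_iso (exchange A X B Y).
Proof.
rewrite exchangeE; apply: isoM; [apply: isoM|]; [exact: iso_assocV| |exact: iso_assoc].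
by apply: iso_tensm; [exact: iso1 | exact: iso_swap].
Qed.

Lemma exchange_assoc (A B D X Y Z : C) :
  (assoc A B D ⊠ assoc X Y Z) ∘ exchange (A ⊗ B) (X ⊗ Y) D Z
    ∘ (exchange A X B Y ⊠ idm (D ⊗ Z)) =
  exchange A X (B ⊗ D) (Y ⊗ Z) ∘ (idm (A ⊗ X) ⊠ exchange B Y D Z)
    ∘ assoc (A ⊗ X) (B ⊗ Y) (D ⊗ Z).
Proof.
set W := D ⊗ Z; set V := X ⊗ (Y ⊗ Z).
pose S := (idm B ⊠ swap X D (Y ⊗ Z)) ∘ (idm B ⊠ (idm X ⊠ swap Y D Z))
            ∘ swap X B (Y ⊗ W) ∘ (idm X ⊠ assoc B Y W).
pose E := (idm A ⊠ S) ∘ assoc A X (B ⊗ Y ⊗ W) ∘ assoc (A ⊗ X) (B ⊗ Y) W.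
have isoT : is_iso ((idm A ⊠ assoc B D V) ∘ assoc A (B ⊗ D) V).
  by apply: isoM; [apply: iso_tensm|]; [exact: iso1|exact: iso_assoc..].
apply: (iso_mono isoT); transitivity E.
- have e1 : (idm A ⊠ assoc B D V) ∘ assoc A (B ⊗ D) V
            ∘ (assoc A B D ⊠ assoc X Y Z) =
      assoc A B (D ⊗ V) ∘ (idm (A ⊗ B) ⊠ (idm D ⊠ assoc X Y Z))
        ∘ assoc (A ⊗ B) D (X ⊗ Y ⊗ Z).
    have -> : assoc A B D ⊠ assoc X Y Z =
        (assoc A B D ⊠ idm V) ∘ (idm (A ⊗ B ⊗ D) ⊠ assoc X Y Z).
      by rewrite -tensm_comp comp1m compm1.
    by rewrite compA pentagon -!tensm1 -!compA assoc_nat.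
  rewrite !exchangeE !compA e1.
  rewrite -[_ ∘ assocV (A ⊗ B) _ _]compA assocVK compm1.
  rewrite -[_ ∘ (_ ⊠ swap (X ⊗ Y) D Z)]compA -tensm_1comp swap_tensl.
  have e2 P Q (s : hom P Q) : assoc A B Q ∘ (idm (A ⊗ B) ⊠ s) =
      (idm A ⊠ (idm B ⊠ s)) ∘ assoc A B P by rewrite -tensm1 assoc_nat.
  rewrite e2 -[_ ∘ assoc A B _ ∘ _]compA -pentagon !compA.
  rewrite -[_ ∘ (assoc A B (X ⊗ Y) ⊠ idm W) ∘ _]compA -tensm_comp1 !compA.
  rewrite assocVK comp1m tensm_comp1 !compA.
  rewrite -[_ ∘ assoc A (B ⊗ (X ⊗ Y)) W ∘ _]compA assoc_nat !compA.
  rewrite -!tensm_1comp /E -[RHS]compA -pentagon !compA -tensm_1comp.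
  congr ((_ ⊠ _) ∘ _ ∘ _); rewrite /S -!compA !compA 2!tensm_1comp.
  rewrite -[_ ∘ assoc B (X ⊗ Y) W]compA -[_ ∘ (swap X B Y ⊠ _)]compA.
  by rewrite swap_whisk !compA.
- rewrite /E !exchangeE !compA.
  rewrite -[_ ∘ assocV A (B ⊗ D) _]compA assocVK compm1.
  rewrite -tensm_1comp swap_tensr.
  have e2 P Q (s : hom P Q) : assoc A X Q ∘ (idm (A ⊗ X) ⊠ s) =
      (idm A ⊠ (idm X ⊠ s)) ∘ assoc A X P by rewrite -tensm1 assoc_nat.
  rewrite -[in RHS](compA _ (assoc A X _)) e2 !compA -tensm_1comp.
  congr ((_ ⊠ _) ∘ _ ∘ _); rewrite /S -[RHS]compA -[in RHS]tensm_1comp.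
  rewrite !compA assocVK comp1m [in RHS]tensm_1comp !compA.
  by rewrite -[_ ∘ swap X B (D ⊗ (Y ⊗ Z)) ∘ _]compA swap_nat !compA.
Qed.

End Braided.

Definition addI (M : nat) (m n : 'I_M) : 'I_M :=
  Ordinal (ltn_pmod (m + n) (leq_ltn_trans (leq0n m) (ltn_ord m))).

Lemma addIA (M : nat) (m n p : 'I_M) : addI (addI m n) p = addI m (addI n p).
Proof. by apply: val_inj; rewrite /= modnDml modnDmr addnA. Qed.

Lemma addIC (M : nat) (m n : 'I_M) : addI n m = addI m n.
Proof. by apply: val_inj; rewrite /= addnC. Qed.

Section Grading.
Variables (k : fieldType) (C : braided_category k).

(* membership in the subcategory C_m of the grading defined by (g, z) *)
Definition in_degree (g : C) (z : k) (m : nat) (X : C) : Prop :=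
  braid g X ∘ braid X g = z ^+ m *: idm (X ⊗ g).

(* the homogeneous components X_m of every object X *)
Record homogeneous_decomposition (g : C) (M : nat) (z : k) :=
  HomogeneousDecomposition {
  hcomp : C -> 'I_M -> C;
  hinc : forall (X : C) (m : 'I_M), hom (hcomp X m) X;
  hprj : forall (X : C) (m : 'I_M), hom X (hcomp X m);
  hcomp_degree : forall (X : C) (m : 'I_M), in_degree g z m (hcomp X m);
  hcomp_biproduct : forall X : C, is_biproduct (hinc X) (hprj X) }.

Record direct_sums (M : nat) := DirectSums {
  dsum : ('I_M -> C) -> C;
  dinc : forall (Y : 'I_M -> C) (m : 'I_M), hom (Y m) (dsum Y);
  dprj : forall (Y : 'I_M -> C) (m : 'I_M), hom (dsum Y) (Y m);
  dsum_biproduct : forall Y : 'I_M -> C, is_biproduct (dinc Y) (dprj Y) }.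

Lemma invertible_faithful (g X Y : C) (f : hom X Y) :
  invertible g -> f ⊠ idm g = 0 -> f = 0.
Proof.
move=> [h [[e ie] _]] f0; apply: runit_faithful; rewrite tensm0l.
apply: (iso_epi (iso_tensm (iso1 X) ie)); rewrite comp0l.
rewrite -tensm_comp compm1 comp1m -[f]comp1m -[e]compm1 tensm_comp -tensm1.
apply: (iso_epi (iso_assoc X g h)).
by rewrite -compA -assoc_nat f0 tensm0l !comp0r comp0l.
Qed.

Lemma in_degree_unit (g : C) (z : k) : in_degree g z 0 munit.
Proof. by rewrite /in_degree double_braid1 expr0 scale1r. Qed.

Lemma in_degree_tens (g X Y : C) (z : k) (m n : nat) :
  in_degree g z m X -> in_degree g z n Y -> in_degree g z (m + n) (X ⊗ Y).
Proof.
rewrite /in_degree => dX dY; rewrite double_braid_tens dX.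
rewrite tensmZl compZr !compZl tensm1 compm1 exprD -scalerA; congr (_ *: _).
rewrite -[_ ∘ assoc X g Y ∘ _]compA assocVK compm1.
rewrite -[_ ∘ (_ ⊠ braid g Y) ∘ _]compA -tensm_comp dY comp1m.
by rewrite tensmZr compZr compZl tensm1 compm1 assocK.
Qed.

Lemma in_degree_mod (g X : C) (z : k) (M m : nat) : M.-primitive_root z ->
  in_degree g z m X -> in_degree g z (m %% M) X.
Proof. by move=> pz; rewrite /in_degree prim_expr_mod. Qed.

Lemma hom_degree (g X Y : C) (z : k) (M : nat) (m n : 'I_M) (f : hom X Y) :
  invertible g -> M.-primitive_root z ->
  in_degree g z m X -> in_degree g z n Y -> m != n -> f = 0.
Proof.
move=> ig pz dX dY mn; apply: (invertible_faithful ig).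
have : braid g Y ∘ braid Y g ∘ (f ⊠ idm g) = (f ⊠ idm g) ∘ (braid g X ∘ braid X g).
  by rewrite -compA braid_nat !compA braid_nat.
rewrite dX dY compZl compZr comp1m compm1 => /eqP.
rewrite -subr_eq0 -scalerBl scaler_eq0 subr_eq0 (eq_prim_root_expr pz).
rewrite !modn_small ?ltn_ord // => /orP[/eqP/val_inj nm|/eqP //].
by rewrite nm eqxx in mn.
Qed.

End Grading.

Section GradedExtension.
Variables (k : fieldType) (C : braided_category k).
Variables (g : C) (M : nat) (z : k).
Variables (D : homogeneous_decomposition g M z) (S : direct_sums C M).
Variable G : 'I_M -> C.
Variable t : forall (m n : 'I_M) (X Y : C),
  hom ((G m ⊗ X) ⊗ (G n ⊗ Y)) (G (addI m n) ⊗ (X ⊗ Y)).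

(* The additive extension to all objects of X_m |-> G_m ⊗ X_m (X_m of
   degree m), whose structure map is t m n X_m Y_n on X_m, Y_n. *)

Definition ext_summand (X : C) (m : 'I_M) : C := G m ⊗ hcomp D X m.

Definition ext_obj (X : C) : C := dsum S (ext_summand X).

Definition ext_map (X Y : C) (f : hom X Y) : hom (ext_obj X) (ext_obj Y) :=
  \sum_m (dinc S (ext_summand Y) m
          ∘ (idm (G m) ⊠ (hprj D Y m ∘ f ∘ hinc D X m))
          ∘ dprj S (ext_summand X) m).

Definition ext_tens (X Y : C) : hom (ext_obj X ⊗ ext_obj Y) (ext_obj (X ⊗ Y)) :=
  \sum_m \sum_n
    (dinc S (ext_summand (X ⊗ Y)) (addI m n)
     ∘ (idm (G (addI m n))
        ⊠ (hprj D (X ⊗ Y) (addI m n) ∘ (hinc D X m ⊠ hinc D Y n)))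
     ∘ t m n (hcomp D X m) (hcomp D Y n)
     ∘ (dprj S (ext_summand X) m ⊠ dprj S (ext_summand Y) n)).

Hypothesis g_inv : invertible g.
Hypothesis z_prim : M.-primitive_root z.
Hypothesis t_nat : forall m n X X' Y Y' (x : hom X X') (y : hom Y Y'),
  t m n X' Y' ∘ ((idm (G m) ⊠ x) ⊠ (idm (G n) ⊠ y)) =
  (idm (G (addI m n)) ⊠ (x ⊠ y)) ∘ t m n X Y.
Hypothesis t_iso : forall m n X Y, is_iso (t m n X Y).
Hypothesis t_assoc : forall m n p X Y Z,
  (idcast (congr1 G (addIA m n p)) ⊠ assoc X Y Z)
    ∘ t (addI m n) p (X ⊗ Y) Z ∘ (t m n X Y ⊠ idm (G p ⊗ Z)) =
  t m (addI n p) X (Y ⊗ Z) ∘ (idm (G m ⊗ X) ⊠ t n p Y Z)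
    ∘ assoc (G m ⊗ X) (G n ⊗ Y) (G p ⊗ Z).
Hypothesis G_unit :  forall m : 'I_M, val m = 0%N -> isomorphic (G m) munit.

Local Notation inc := (hinc D).
Local Notation prj := (hprj D).
Local Notation ii X := (dinc S (ext_summand X)).
Local Notation pp X := (dprj S (ext_summand X)).

Lemma prj_inc X m : prj X m ∘ inc X m = idm _.
Proof. by case: (hcomp_biproduct D X). Qed.

Lemma prj_inc0 X m n : m != n -> prj X n ∘ inc X m = 0.
Proof. by case: (hcomp_biproduct D X) => _ + _; apply. Qed.

Lemma inc_prj X : \sum_m (inc X m ∘ prj X m) = idm X.
Proof. by case: (hcomp_biproduct D X). Qed.

Lemma pp_ii X m : pp X m ∘ ii X m = idm _.
Proof. by case: (dsum_biproduct S (ext_summand X)). Qed.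

Lemma pp_ii0 X m n : m != n -> pp X n ∘ ii X m = 0.
Proof. by case: (dsum_biproduct S (ext_summand X)) => _ + _; apply. Qed.

Lemma ii_pp X : \sum_m (ii X m ∘ pp X m) = idm (ext_obj X).
Proof. by case: (dsum_biproduct S (ext_summand X)). Qed.

Lemma degree_hom0 (W X : C) (m n : 'I_M) (h : hom W X) :
  in_degree g z m W -> m != n -> prj X n ∘ h = 0.
Proof. move=> dW; exact: hom_degree (hcomp_degree D X n). Qed.

Lemma degree_hom (W X : C) (m : 'I_M) (h : hom W X) :
  in_degree g z m W -> inc X m ∘ (prj X m ∘ h) = h.
Proof.
move=> dW; rewrite -[RHS]comp1m -inc_prj comp_suml (bigD1 m) //= compA.
rewrite big1 ?addr0 // => n nm; rewrite -compA (degree_hom0 _ dW) ?comp0r //.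
by rewrite eq_sym.
Qed.

Lemma degree_tens (X Y : C) (m n : 'I_M) : in_degree g z m X ->
  in_degree g z n Y -> in_degree g z (addI m n) (X ⊗ Y).
Proof. by move=> dX dY; apply: in_degree_mod => //; apply: in_degree_tens. Qed.

Lemma degree_hcomp2 (X Y : C) (m n : 'I_M) :
  in_degree g z (addI m n) (hcomp D X m ⊗ hcomp D Y n).
Proof. by apply: degree_tens; apply: hcomp_degree. Qed.

Lemma ext_epi (X Y : C) (u v : hom (ext_obj X) Y) :
  (forall m, u ∘ ii X m = v ∘ ii X m) -> u = v.
Proof.
move=> e; rewrite -[u]compm1 -[v]compm1 -ii_pp !comp_sumr.
by apply: eq_bigr => m _; rewrite !compA e.
Qed.

Lemma ii_pp2 X Y : \sum_m \sum_n ((ii X m ⊠ ii Y n) ∘ (pp X m ⊠ pp Y n)) =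
  idm (ext_obj X ⊗ ext_obj Y).
Proof.
rewrite -tensm1 -!ii_pp tensm_suml; apply: eq_bigr => m _.
by rewrite tensm_sumr; apply: eq_bigr => n _; rewrite tensm_comp.
Qed.

Lemma ext_epi2 (X Y Z : C) (u v : hom (ext_obj X ⊗ ext_obj Y) Z) :
  (forall m n, u ∘ (ii X m ⊠ ii Y n) = v ∘ (ii X m ⊠ ii Y n)) -> u = v.
Proof.
move=> e; rewrite -[u]compm1 -[v]compm1 -ii_pp2 !comp_sumr.
apply: eq_bigr => m _; rewrite !comp_sumr.
by apply: eq_bigr => n _; rewrite !compA e.
Qed.

Lemma ext_epi3 (X Y Z W : C)
    (u v : hom (ext_obj X ⊗ ext_obj Y ⊗ ext_obj Z) W) :
  (forall m n p, u ∘ ((ii X m ⊠ ii Y n) ⊠ ii Z p) =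
                 v ∘ ((ii X m ⊠ ii Y n) ⊠ ii Z p)) -> u = v.
Proof.
move=> e; rewrite -[u]compm1 -[v]compm1 -tensm1 -ii_pp2 -ii_pp tensm_suml.
rewrite !comp_sumr; apply: eq_bigr => m _; rewrite tensm_suml !comp_sumr.
apply: eq_bigr => n _; rewrite tensm_sumr !comp_sumr; apply: eq_bigr => p _.
by rewrite tensm_comp !compA e.
Qed.

Lemma map_inc (X Y : C) (f : hom X Y) m :
  ext_map f ∘ ii X m =
  ii Y m ∘ (idm (G m) ⊠ (prj Y m ∘ f ∘ inc X m)).
Proof.
rewrite /ext_map comp_suml (bigD1 m) //= -[_ ∘ pp X m ∘ _]compA pp_ii compm1.
rewrite big1 ?addr0 // => n nm.
by rewrite -[_ ∘ pp X n ∘ _]compA pp_ii0 ?comp0r // eq_sym.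
Qed.

Lemma tens_inc (X Y : C) m n :
  ext_tens X Y ∘ (ii X m ⊠ ii Y n) =
  ii (X ⊗ Y) (addI m n)
    ∘ (idm (G (addI m n)) ⊠ (prj (X ⊗ Y) (addI m n) ∘ (inc X m ⊠ inc Y n)))
    ∘ t m n (hcomp D X m) (hcomp D Y n).
Proof.
rewrite /ext_tens comp_suml (bigD1 m) //=. rewrite [s in _ + s]big1 => [|m' mm].
  rewrite addr0 comp_suml (bigD1 n) //= [s in _ + s]big1 => [|n' nn].
    by rewrite addr0 -[_ ∘ (pp X m ⊠ _) ∘ _]compA -tensm_comp !pp_ii tensm1 compm1.
  by rewrite -[_ ∘ (pp X m ⊠ _) ∘ _]compA -tensm_comp (@pp_ii0 Y) ?tensm0r ?comp0r // eq_sym.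
rewrite comp_suml big1 // => n' _.
by rewrite -[_ ∘ (pp X m' ⊠ _) ∘ _]compA -tensm_comp pp_ii0 ?tensm0l ?comp0r // eq_sym.
Qed.

Lemma ext_id X : ext_map (idm X) = idm (ext_obj X).
Proof.
apply: ext_epi => m; rewrite map_inc compm1 prj_inc.
by rewrite tensm1 compm1 comp1m.
Qed.

Lemma ext_comp (X Y Z : C) (f : hom Y Z) (h : hom X Y) :
  ext_map (f ∘ h) = ext_map f ∘ ext_map h.
Proof.
apply: ext_epi => m; rewrite -compA !map_inc [RHS]compA map_inc.
rewrite -[RHS]compA -tensm_1comp; congr (_ ∘ (_ ⊠ _)); rewrite -!compA.
by rewrite degree_hom //; apply: hcomp_degree.
Qed.

Lemma ext_lin (X Y : C) a (f h : hom X Y) :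
  ext_map (a *: f + h) = a *: ext_map f + ext_map h.
Proof.
apply: ext_epi => m; rewrite comp_linl !map_inc.
by rewrite comp_linr comp_linl tensm_linr comp_linr.
Qed.

Lemma ext_tens_nat (X X' Y Y' : C) (f : hom X X') (h : hom Y Y') :
  ext_tens X' Y' ∘ (ext_map f ⊠ ext_map h) = ext_map (f ⊠ h) ∘ ext_tens X Y.
Proof.
apply: ext_epi2 => m n; rewrite -compA -tensm_comp !map_inc tensm_comp compA.
rewrite tens_inc -!compA t_nat tens_inc !compA map_inc.
congr (_ ∘ _); rewrite -!compA -!tensm_1comp; congr (_ ∘ (_ ⊠ _)).
rewrite -!compA -tensm_comp !degree_hom ?tensm_comp //;
  do ?[exact: hcomp_degree | exact: degree_hcomp2].
Qed.

Lemma ii_cast (X W : C) (a b : 'I_M) (e : a = b) (h : hom W X) :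
  ii X b ∘ (idcast (congr1 G e) ⊠ (prj X b ∘ h)) =
  ii X a ∘ (idm (G a) ⊠ (prj X a ∘ h)).
Proof. by case: b / e. Qed.

Lemma ext_assoc (X Y Z : C) :
  ext_map (assoc X Y Z) ∘ ext_tens (X ⊗ Y) Z
    ∘ (ext_tens X Y ⊠ idm (ext_obj Z)) =
  ext_tens X (Y ⊗ Z) ∘ (idm (ext_obj X) ⊠ ext_tens Y Z)
    ∘ assoc (ext_obj X) (ext_obj Y) (ext_obj Z).
Proof.
apply: ext_epi3 => m n p.
set a := addI (addI m n) p; set b := addI m (addI n p).
set i3 := hinc D X m ⊠ (hinc D Y n ⊠ hinc D Z p).
have dL : in_degree g z a (hcomp D X m ⊗ hcomp D Y n ⊗ hcomp D Z p).
  by apply: degree_tens; [exact: degree_hcomp2 | exact: hcomp_degree].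
have dR : in_degree g z b (hcomp D X m ⊗ (hcomp D Y n ⊗ hcomp D Z p)).
  by apply: degree_tens; [exact: hcomp_degree | exact: degree_hcomp2].
have eL : prj _ a ∘ assoc X Y Z ∘ inc _ a
    ∘ (prj _ a ∘ (inc (X ⊗ Y) (addI m n) ⊠ inc Z p)
       ∘ ((prj _ _ ∘ (inc X m ⊠ inc Y n)) ⊠ idm (hcomp D Z p))) =
    prj _ a ∘ i3 ∘ assoc (hcomp D X m) (hcomp D Y n) (hcomp D Z p).
  rewrite -[RHS]compA -assoc_nat -!compA -tensm_comp compm1.
  by rewrite (degree_hom _ (degree_hcomp2 _ _ _ _)) (degree_hom _ dL).
have eR : prj _ b ∘ (inc X m ⊠ inc (Y ⊗ Z) (addI n p))
       ∘ (idm (hcomp D X m) ⊠ (prj _ _ ∘ (inc Y n ⊠ inc Z p))) =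
    prj _ b ∘ i3.
  rewrite -!compA -tensm_comp compm1.
  by rewrite (degree_hom _ (degree_hcomp2 _ _ _ _)).
transitivity (ii (X ⊗ (Y ⊗ Z)) b ∘ (idm (G b) ⊠ (prj _ b ∘ i3))
  ∘ t m (addI n p) (hcomp D X m) (hcomp D Y n ⊗ hcomp D Z p)
  ∘ (idm (ext_summand X m) ⊠ t n p (hcomp D Y n) (hcomp D Z p))
  ∘ assoc (ext_summand X m) (ext_summand Y n) (ext_summand Z p)).
- rewrite -[LHS]compA -tensm_comp comp1m tens_inc.
  have -> : (ii (X ⊗ Y) (addI m n)
      ∘ (idm (G (addI m n)) ⊠ (prj (X ⊗ Y) (addI m n) ∘ (inc X m ⊠ inc Y n)))
      ∘ t m n (hcomp D X m) (hcomp D Y n)) ⊠ ii Z p =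
    (ii (X ⊗ Y) (addI m n) ⊠ ii Z p) ∘
    ((idm (G (addI m n)) ⊠ (prj (X ⊗ Y) (addI m n) ∘ (inc X m ⊠ inc Y n)))
      ⊠ (idm (G p) ⊠ idm (hcomp D Z p)))
    ∘ (t m n (hcomp D X m) (hcomp D Y n) ⊠ idm _).
    by rewrite tensm1 -!tensm_comp !compm1.
  rewrite !compA -[_ ∘ _ ∘ (ii _ _ ⊠ _)]compA tens_inc !compA map_inc.
  rewrite -[_ ∘ t _ _ _ _ ∘ _]compA t_nat !compA.
  rewrite -[s in s ∘ t _ _ _ _ ∘ _]compA -tensm_1comp.
  rewrite -[s in s ∘ t _ _ _ _ ∘ _]compA -tensm_1comp eL.
  rewrite -[RHS]compA -[RHS]compA [in RHS](compA (t _ _ _ _)) -t_assoc !compA.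
  rewrite -[in RHS](compA _ _ (idcast _ ⊠ _)) -tensm_comp comp1m.
  by rewrite -!(compA (hprj D _ _)) ii_cast.
- rewrite -[RHS]compA -[RHS]compA assoc_nat [in RHS](compA (idm _ ⊠ _)).
  rewrite -tensm_comp comp1m tens_inc.
  have -> : ii X m ⊠ (ii (Y ⊗ Z) (addI n p)
      ∘ (idm (G (addI n p)) ⊠ (prj (Y ⊗ Z) (addI n p) ∘ (inc Y n ⊠ inc Z p)))
      ∘ t n p (hcomp D Y n) (hcomp D Z p)) =
    (ii X m ⊠ ii (Y ⊗ Z) (addI n p)) ∘
    ((idm (G m) ⊠ idm (hcomp D X m)) ⊠
     (idm (G (addI n p)) ⊠ (prj (Y ⊗ Z) (addI n p) ∘ (inc Y n ⊠ inc Z p))))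
    ∘ (idm _ ⊠ t n p (hcomp D Y n) (hcomp D Z p)).
    by rewrite tensm1 -!tensm_comp !compm1.
  rewrite !compA tens_inc -[in RHS](compA _ (t _ _ _ _)) t_nat !compA.
  by rewrite -[in RHS](compA (ii _ _)) -tensm_1comp eR.
Qed.

Lemma ext_tens_iso (X Y : C) : is_iso (ext_tens X Y).
Proof.
have ex m n : exists u : hom (G (addI m n) ⊗ (hcomp D X m ⊗ hcomp D Y n))
                             (ext_summand X m ⊗ ext_summand Y n),
    (u ∘ t m n _ _ == idm _) && (t m n _ _ ∘ u == idm _).
  by have [u [ut tu]] := t_iso m n (hcomp D X m) (hcomp D Y n);
     exists u; rewrite ut tu !eqxx.
pose ti m n := xchoose (ex m n).
have tiK m n : ti m n ∘ t m n _ _ = idm _.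
  by have /andP[/eqP] := xchooseP (ex m n).
have tK m n : t m n _ _ ∘ ti m n = idm _.
  by have /andP[_ /eqP] := xchooseP (ex m n).
pose r m n := (prj X m ⊠ prj Y n) ∘ inc (X ⊗ Y) (addI m n).
pose J := \sum_m \sum_n ((ii X m ⊠ ii Y n) ∘ ti m n
  ∘ (idm (G (addI m n)) ⊠ r m n) ∘ pp (X ⊗ Y) (addI m n)).
exists J; split.
- apply: ext_epi2 => m n; rewrite -compA tens_inc comp1m.
  have key m' n' : ~~ ((m' == m) && (n' == n)) ->
      (ii X m' ⊠ ii Y n') ∘ ti m' n' ∘ (idm (G (addI m' n')) ⊠ r m' n')
      ∘ pp _ (addI m' n') ∘ (ii _ (addI m n) ∘ (idm (G (addI m n))
          ⊠ (prj (X ⊗ Y) (addI m n) ∘ (inc X m ⊠ inc Y n)))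
          ∘ t m n (hcomp D X m) (hcomp D Y n)) = 0.
    move=> ne.
    have e0 : (prj X m' ⊠ prj Y n') ∘ (inc X m ⊠ inc Y n) = 0.
      rewrite -tensm_comp; move: ne; rewrite negb_and => /orP[ne|ne].
        by rewrite prj_inc0 ?tensm0l // eq_sym.
      by rewrite (@prj_inc0 Y) ?tensm0r // eq_sym.
    suff e1 : (idm (G (addI m' n')) ⊠ r m' n') ∘ pp _ (addI m' n')
      ∘ (ii _ (addI m n) ∘ (idm (G (addI m n))
          ⊠ (prj (X ⊗ Y) (addI m n) ∘ (inc X m ⊠ inc Y n)))) = 0.
      have -> u v w : u ∘ (idm (G (addI m' n')) ⊠ r m' n')
          ∘ pp (X ⊗ Y) (addI m' n') ∘ (v ∘ w) =
          u ∘ ((idm (G (addI m' n')) ⊠ r m' n') ∘ pp _ (addI m' n') ∘ v) ∘ w.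
        by rewrite !compA.
      by rewrite e1 comp0r comp0l.
    move: (degree_hcomp2 X Y m n) e0; rewrite /r.
    move: (addI m' n') (addI m n) => a b db e0.
    have [<-|ab] := eqVneq b a.
      rewrite -[LHS]compA (compA (pp _ _)) pp_ii comp1m -tensm_1comp.
      by rewrite -compA degree_hom // e0 tensm0r.
    by rewrite -[LHS]compA (compA (pp _ _)) pp_ii0 // comp0l comp0r.
  rewrite /J comp_suml (bigD1 m) //= [s in _ + s]big1 => [|m' mm].
    rewrite addr0 comp_suml (bigD1 n) //= [s in _ + s]big1 => [|n' nn].
      rewrite addr0 -[(_ ∘ pp _ _) ∘ _]compA (compA (pp _ _)) (compA (pp _ _)).
      rewrite pp_ii comp1m -!compA (compA (_ ⊠ r _ _)) -tensm_1comp /r.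
      rewrite -compA degree_hom; last exact: degree_hcomp2.
      by rewrite -tensm_comp !prj_inc !tensm1 comp1m tiK compm1.
    by rewrite key // (negPf nn) andbF.
  by rewrite comp_suml big1 // => n' _; rewrite key // (negPf mm).
- pose q m n := (inc X m ∘ prj X m) ⊠ (inc Y n ∘ prj Y n).
  rewrite /J comp_sumr -ext_id -tensm1 -!inc_prj tensm_suml.
  have mapD (Z W : C) : {morph @ext_map Z W : f h / f + h}.
    by move=> f h; rewrite -[f]scale1r ext_lin !scale1r.
  have map0 (Z W : C) : @ext_map Z W 0 = 0.
    by apply: (addrI (ext_map 0)); rewrite -mapD !addr0.
  rewrite (big_morph _ (mapD _ _) (map0 _ _)); apply: eq_bigr => m _.
  rewrite comp_sumr tensm_sumr (big_morph _ (mapD _ _) (map0 _ _)).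
  apply: eq_bigr => n _; rewrite !compA tens_inc.
  rewrite -[_ ∘ t _ _ _ _ ∘ _]compA tK compm1.
  rewrite -[_ ∘ (_ ⊠ r m n)]compA -tensm_1comp.
  rewrite /ext_map (bigD1 (addI m n)) //= big1 ?addr0 => [|b bm].
    by rewrite /r tensm_comp !compA.
  rewrite tensm_comp compA (degree_hom0 _ (degree_hcomp2 _ _ m n)).
    by rewrite !comp0l tensm0r comp0r comp0l.
  by rewrite eq_sym.
Qed.

Lemma ext_unit : isomorphic (ext_obj munit) munit.
Proof.
have M0 := prim_order_gt0 z_prim; pose o : 'I_M := Ordinal M0.
have inc0 m : m != o -> hinc D munit m = 0.
  move=> mo; have d1 : in_degree g z o munit by exact: in_degree_unit.
  exact: hom_degree (hcomp_degree D munit m) d1 mo.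
have isoU : isomorphic (hcomp D munit o) munit.
  exists (inc munit o), (prj munit o); rewrite prj_inc; split=> //.
  rewrite -inc_prj (bigD1 o) //= big1 ?addr0 // => m mo.
  by rewrite inc0 // comp0l.
have isoG : isomorphic (ext_obj munit) (ext_summand munit o).
  exists (pp munit o), (ii munit o); rewrite pp_ii; split=> //.
  rewrite -ii_pp (bigD1 o) //= big1 ?addr0 // => m mo.
  rewrite -[ii _ _]compm1 -tensm1 -prj_inc inc0 //.
  by rewrite comp0r tensm0r comp0r comp0l.
apply: (isomorphic_trans isoG); have [f fi] := isoU.
have [h hi] := @G_unit o erefl.
exists (lunit munit ∘ (h ⊠ f)); apply: isoM; first exact: iso_lunit.
exact: iso_tensm.
Qed.

Definition graded_extension : monoidal_functor C :=
  {| mf_obj := ext_obj;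
     mf_map := ext_map;
     mf_tens := ext_tens;
     mf_id := ext_id;
     mf_comp := ext_comp;
     mf_lin := ext_lin;
     mf_tens_nat := ext_tens_nat;
     mf_tens_iso := ext_tens_iso;
     mf_assoc := ext_assoc;
     mf_unit := ext_unit |}.

End GradedExtension.

Section SimpleCurrent.
Variables (k : fieldType) (C : braided_category k).

Lemma tpowD (g : C) m n : isomorphic (tpow g m ⊗ tpow g n) (tpow g (m + n)).
Proof.
elim: n => [|n [f fi]] /=.
  by rewrite addn0; exists (runit (tpow g m)); apply: iso_runit.
rewrite addnS /=; exists ((f ⊠ idm g) ∘ assocV (tpow g m) (tpow g n) g).
by apply: isoM; [apply: iso_tensm; [|exact: iso1] | exact: iso_assocV].
Qed.

Lemma tpow_mod (g : C) M m n : has_tensor_order g M ->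
  (m < M)%N -> (n < M)%N ->
  isomorphic (tpow g m ⊗ tpow g n) (tpow g ((m + n) %% M)).
Proof.
move=> [M0 [e ei] _] mM nM; apply: (isomorphic_trans (tpowD g m n)).
case: (ltnP (m + n) M) => le_mn.
  by rewrite modn_small //; exact: isomorphic_refl.
have -> : ((m + n) %% M = m + n - M)%N.
  rewrite -[in LHS](subnK le_mn) modnDr modn_small //.
  by rewrite ltn_subLR //; apply: (@ltn_trans (M + n)); rewrite ?ltn_add2r ?ltn_add2l.
rewrite -[s in isomorphic (tpow g s)](subnKC le_mn).
apply: (isomorphic_trans (isomorphic_sym (tpowD g M _))).
exists (lunit _ ∘ (e ⊠ idm (tpow g (m + n - M)))).
by apply: isoM; [exact: iso_lunit | apply: iso_tensm => //; exact: iso1].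
Qed.

Lemma basis_iso (X Y : C) (v : hom X Y) :
  isomorphic X Y -> basis_of fullv [:: v] -> is_iso v.
Proof.
move=> [f [h [hf fh]]] vb.
have /vlineP[a fE] : f \in <[v]>%VS by rewrite -span_seq1 (span_basis vb) memvf.
by exists (a *: h); rewrite compZl compZr -compZr -compZl -fE.
Qed.

(* The idcast's identify g^((m+n)+p) with g^(m+(n+p)), and g^(n+m) with
   g^(m+n), where the exponents are reduced modulo M. *)
Record current_basis (g : C) (M : nat) (q : k) := CurrentBasis {
  cb : forall m n : 'I_M, hom (tpow g m ⊗ tpow g n) (tpow g (addI m n));
  cb_basis : forall m n : 'I_M, basis_of fullv [:: cb m n];
  cb_assoc : forall m n p : 'I_M,
    idcast (congr1 (fun i : 'I_M => tpow g i) (addIA m n p))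
      ∘ cb (addI m n) p ∘ (cb m n ⊠ idm (tpow g p)) =
    cb m (addI n p) ∘ (idm (tpow g m) ⊠ cb n p)
      ∘ assoc (tpow g m) (tpow g n) (tpow g p);
  cb_braid : forall m n : 'I_M,
    idcast (congr1 (fun i : 'I_M => tpow g i) (addIC m n))
      ∘ cb n m ∘ braid (tpow g m) (tpow g n) =
    q ^+ (m * n) *: cb m n }.

Section Construction.
Variables (g : C) (M : nat) (q z : k) (v : current_basis g M q).

Lemma comp_regroup (X Y Z W V U : C) (a : hom V U) (b : hom W V)
  (c : hom Z W) (d : hom Y Z) (e : hom X Y) :
  a ∘ b ∘ (c ∘ d) ∘ e = a ∘ (b ∘ c) ∘ (d ∘ e).
Proof. by rewrite !compA. Qed.

Lemma comp_regroup' (X Y Z W V U : C) (a : hom V U) (b : hom W V)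
  (c : hom Z W) (d : hom Y Z) (e : hom X Y) :
  a ∘ (b ∘ c) ∘ (d ∘ e) = a ∘ b ∘ (c ∘ d ∘ e).
Proof. by rewrite !compA. Qed.

(* tau_{X,Y} for X in C_m and Y in C_n *)
Definition tau (m n : 'I_M) (X Y : C) :
    hom ((tpow g m ⊗ X) ⊗ (tpow g n ⊗ Y)) (tpow g (addI m n) ⊗ (X ⊗ Y)) :=
  (cb v m n ⊠ idm (X ⊗ Y)) ∘ exchange (tpow g m) X (tpow g n) Y.

Lemma tau_nat m n X X' Y Y' (x : hom X X') (y : hom Y Y') :
  tau m n X' Y' ∘ ((idm (tpow g m) ⊠ x) ⊠ (idm (tpow g n) ⊠ y)) =
  (idm (tpow g (addI m n)) ⊠ (x ⊠ y)) ∘ tau m n X Y.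
Proof.
rewrite /tau -[LHS]compA exchange_nat [LHS]compA [RHS]compA -!tensm_comp.
by rewrite tensm1 !compm1 !comp1m.
Qed.

Lemma tau_assoc m n p X Y Z :
  (idcast (congr1 (fun i : 'I_M => tpow g i) (addIA m n p)) ⊠ assoc X Y Z)
    ∘ tau (addI m n) p (X ⊗ Y) Z ∘ (tau m n X Y ⊠ idm (tpow g p ⊗ Z)) =
  tau m (addI n p) X (Y ⊗ Z) ∘ (idm (tpow g m ⊗ X) ⊠ tau n p Y Z)
    ∘ assoc (tpow g m ⊗ X) (tpow g n ⊗ Y) (tpow g p ⊗ Z).
Proof.
transitivity (((cb v m (addI n p) ∘ (idm _ ⊠ cb v n p)) ⊠ idm (X ⊗ (Y ⊗ Z)))
  ∘ (exchange (tpow g m) X (tpow g n ⊗ tpow g p) (Y ⊗ Z)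
     ∘ (idm (tpow g m ⊗ X) ⊠ exchange (tpow g n) Y (tpow g p) Z)
     ∘ assoc (tpow g m ⊗ X) (tpow g n ⊗ Y) (tpow g p ⊗ Z))).
- rewrite -exchange_assoc /tau tensm_comp1.
  have -> : (cb v m n ⊠ idm (X ⊗ Y)) ⊠ idm (tpow g p ⊗ Z) =
      (cb v m n ⊠ idm (X ⊗ Y)) ⊠ (idm (tpow g p) ⊠ idm Z) by rewrite !tensm1.
  rewrite [LHS]compA (compA (_ ⊠ assoc _ _ _)) -(compA _ (exchange _ _ _ _)).
  rewrite exchange_nat [RHS]compA (compA _ (_ ⊠ _) (exchange _ _ _ _)).
  rewrite (compA _ (assoc _ _ _ ⊠ assoc _ _ _)); congr (_ ∘ _ ∘ _).
  by rewrite -!tensm_comp tensm1 !compm1 comp1m cb_assoc.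
- rewrite /tau tensm_1comp.
  have -> : idm (tpow g m ⊗ X) ⊠ (cb v n p ⊠ idm (Y ⊗ Z)) =
     (idm (tpow g m) ⊠ idm X) ⊠ (cb v n p ⊠ idm (Y ⊗ Z)) by rewrite !tensm1.
  rewrite comp_regroup exchange_nat comp_regroup' -tensm_comp.
  by rewrite tensm1 comp1m.
Qed.

Hypothesis g_inv : invertible g.
Hypothesis g_order : has_tensor_order g M.
Hypothesis z_prim : M.-primitive_root z.

Lemma tau_iso m n X Y : is_iso (tau m n X Y).
Proof.
apply: isoM; last exact: iso_exchange.
apply: iso_tensm; last exact: iso1.
apply: basis_iso; last exact: cb_basis.
exact: tpow_mod g_order (ltn_ord m) (ltn_ord n).
Qed.

Lemma tpow_unit (m : 'I_M) : val m = 0%N -> isomorphic (tpow g m) munit.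
Proof. by move=> /= ->; apply: isomorphic_refl. Qed.

(* The auto-equivalence F_(g,z) *)
Definition simple_current (D : homogeneous_decomposition g M z)
    (S : direct_sums C M) : monoidal_functor C :=
  graded_extension D S g_inv z_prim tau_nat tau_iso tau_assoc tpow_unit.

End Construction.
End SimpleCurrent.

(* Main.v *)
From Pilot Require Import Defs.
From mathcomp Require Import all_boot all_order all_algebra.
From mathcomp Require Import reals complex boolp ring zify.
Import Pilot.Defs.

(** Write [F] for the auto-equivalence and [A] for the degree of [g]: the double
braiding of [g] with itself is [q ^+ 2 = zeta ^+ A].  On an object [X] of
degree [m] the functor is [g^m ⊗ X], which has degree [(A + 1) m].  Iterating,
[F^K X] is a product of powers of [g] with [X]; multiplying these powers
together by the chosen maps [v] gives an isomorphism [F^K X = g^(e m) ⊗ X] with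
[e = 1 + (A + 1) + ... + (A + 1)^(K - 1)], so that [A * e + 1 = (A + 1) ^ K].  As
[A] is positive, the congruence on [K] says that [M] divides [e]; thus [F^K X] is
isomorphic to [X], naturally in homogeneous [X].

It remains to compare the monoidal structures.  To multiply the powers of [g]
coming from [X] with those coming from [Y], some powers of [g] have to be
moved past each other, and each such move costs a scalar [q ^+ (i * j)]
([mu_exchange]).  Hence the isomorphism above respects the monoidal structures
up to a factor [x ^+ (m * n)] in degrees [m] and [n], where [x ^+ M = 1].  Such
a factor is a symmetric 2-cocycle on the cyclic group of order [M]; since
every scalar has an [M]-th root, it is the coboundary of a function [f] of
the degree ([quadratic_refinement]), and rescaling the isomorphism by [f]
removes it ([presented_scale]).

The bookkeeping is done by the predicate [presented H a chi]: the functor [H]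
is [X |-> g^(a m) ⊗ X] in degree [m], with the structure maps of [F] twisted by
[chi].  The identity and [F] are presented ([presented_one],
[presented_simple_current]), a composite of presented functors is presented
([presented_compose]), and two functors with the same presentation are
monoidally isomorphic ([presented_unique]). *)

Set Implicit Arguments.
Unset Strict Implicit.
Unset Printing Implicit Defensive.
Import GRing.Theory Num.Theory.
Local Open Scope ring_scope.
Local Open Scope cat_scope.

(** * Coherence for the exchange of the inner factors *)

Section Coherence.
Variables (k : fieldType) (C : braided_category k).

(** The exchange maps are the structure maps of the monoidal functor [⊗]; this
is the coherence square that mirrors [exchange_assoc].  Both sides carry
[A'] past [X] and then past [B], and [B'] past [X]; the left side takes [A'] past
the block [B ⊗ X] and then [B'] past [X], the right side takes the block
[A' ⊗ B'] past [X] and then [A'] past [B].  The two are identified by the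
hexagons, in the form [swap_tensl] and [swap_tensr]. *)
Lemma exchange_exchange (A B X A' B' Y : C) :
  assocV (A ⊗ A') (B ⊗ B') (X ⊗ Y) ∘ (idm (A ⊗ A') ⊠ exchange B X B' Y)
    ∘ exchange A (B ⊗ X) A' (B' ⊗ Y) ∘ (assoc A B X ⊠ assoc A' B' Y) =
  (exchange A B A' B' ⊠ idm (X ⊗ Y)) ∘ exchange (A ⊗ B) X (A' ⊗ B') Y.
Proof.
pose V := X ⊗ Y; pose W := B' ⊗ Y.
pose s := (idm A' ⊠ (idm B ⊠ swap X B' Y)) ∘ swap B A' (X ⊗ W)
  ∘ (idm B ⊠ swap X A' W).
(* The common value of both sides, with all brackets moved to the right. *)
pose E := (idm A ⊠ s) ∘ assoc A B (X ⊗ (A' ⊗ W))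
  ∘ assoc (A ⊗ B) X (A' ⊗ W) ∘ (idm (A ⊗ B ⊗ X) ⊠ assoc A' B' Y).
pose r := (idm A ⊠ (idm A' ⊠ assoc B B' V))
  ∘ assoc A A' ((B ⊗ B') ⊗ V) ∘ assoc (A ⊗ A') (B ⊗ B') V.
have r_iso : is_iso r.
  apply: isoM; last exact: iso_assoc.
  by do ?[apply: isoM | apply: iso_tensm | exact: iso_assoc | exact: iso1].
have assocE (P Q Q' U : C) (f : hom Q Q') :
    assoc P U Q' ∘ (idm (P ⊗ U) ⊠ f) = (idm P ⊠ (idm U ⊠ f)) ∘ assoc P U Q.
  by rewrite -tensm1 assoc_nat.
apply: (iso_mono r_iso); transitivity E.
- have e1 : assoc B B' V ∘ exchange B X B' Y =
      (idm B ⊠ swap X B' Y) ∘ assoc B X W.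
    by rewrite exchangeE !compA assocVK comp1m.
  have e2 : assoc A B X ⊠ assoc A' B' Y =
      (assoc A B X ⊠ idm (A' ⊗ W)) ∘ (idm (A ⊗ B ⊗ X) ⊠ assoc A' B' Y).
    by rewrite -tensm_comp comp1m compm1.
  rewrite /r /E e2 (exchangeE A) -!compA.
  rewrite (compE _ (assocVK _ _ _)) comp1m (compE _ (assocE _ _ _ _ _)) -!compA.
  rewrite (compE _ (assocVK _ _ _)) comp1m !compA; congr (_ ∘ _).
  rewrite -!tensm_1comp -!compA e1 tensm_1comp -!compA.
  rewrite -pentagon !compA -!tensm_1comp; congr (_ ⊠ _ ∘ _ ∘ _).
  by rewrite /s tensm_1comp -!compA swap_tensl !compA.
- have e1 : r ∘ (exchange A B A' B' ⊠ idm V) =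
      (idm A ⊠ (swap B A' (B' ⊗ V) ∘ (idm B ⊠ assoc A' B' V)))
        ∘ assoc A B ((A' ⊗ B') ⊗ V) ∘ assoc (A ⊗ B) (A' ⊗ B') V.
    rewrite /r -(compA _ (assoc A A' _)) -pentagon exchangeE.
    rewrite -!compA -tensm_comp1 !compA assocVK comp1m tensm_comp1 -!compA.
    rewrite (compE _ (assoc_nat _ _ _)) -!compA -pentagon !compA -!tensm_1comp.
    by rewrite swap_whisk.
  have e2 : swap B A' (B' ⊗ V) ∘ (idm B ⊠ (assoc A' B' V ∘ swap X (A' ⊗ B') Y))
      = s ∘ (idm B ⊠ (idm X ⊠ assoc A' B' Y)).
    by rewrite swap_tensr !tensm_1comp !compA swap_nat.
  rewrite (compA r) e1 exchangeE -!compA (compE _ (assocVK _ _ _)) comp1m.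
  rewrite (compE _ (assocE _ _ _ _ _)) -!compA (compA (idm A ⊠ _)).
  rewrite -tensm_1comp -!compA -tensm_1comp e2 tensm_1comp /E.
  rewrite -!compA assocE (compE _ (assocE _ _ _ _ _)).
  by rewrite !compA.
Qed.

Lemma exchange_unit (X Y : C) :
  lunit (X ⊗ Y) ∘ (lunit munit ⊠ idm (X ⊗ Y)) ∘ exchange munit X munit Y =
  lunit X ⊠ lunit Y.
Proof.
rewrite exchangeE -lunit_tens !compA -(compA _ (assoc _ _ _)) assocVK compm1.
rewrite -(compA (lunit _) (lunit _)) lunit_nat (compA (lunit _)).
rewrite -(compA _ (lunit _)).
rewrite lunit_tens swapE !compA lunit_tens -tensm_comp1 lunit_braid.
rewrite -triangle -(compA _ (assoc X munit Y)) assocVK compm1.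
by rewrite -tensm_comp comp1m compm1.
Qed.

End Coherence.

(** * Complements on linear and monoidal categories *)

Section Category.
Variables (k : fieldType) (C : monoidal_category k).

(** Being an isomorphism is a mere proposition about existence; the equality of
morphisms being decidable, an inverse can nevertheless be selected, which is
needed to build natural transformations object by object. *)
Lemma iso_inverse (X Y : C) (f : hom X Y) : is_iso f ->
  {f' : hom Y X | f' ∘ f = idm X & f ∘ f' = idm Y}.
Proof.
move=> fi; have ex : exists f', (f' ∘ f == idm X) && (f ∘ f' == idm Y).
  by have [f' [f'f ff']] := fi; exists f'; rewrite f'f ff' !eqxx.
by exists (xchoose ex); have /andP[/eqP ? /eqP ?] := xchooseP ex.
Qed.

Lemma iso_scale (X Y : C) (a : k) (f : hom X Y) :
  a != 0 -> is_iso f -> is_iso (a *: f).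
Proof.
move=> a0 [f' [f'f ff']]; exists (a^-1 *: f').
by rewrite !compZl !compZr !scalerA mulVf ?mulfV // f'f ff' !scale1r.
Qed.

Lemma mf_add (F : monoidal_functor C) (X Y : C) :
  {morph @mf_map _ _ F X Y : u v / u + v}.
Proof. by move=> u v; rewrite -[u]scale1r mf_lin !scale1r. Qed.

Lemma mf_zero (F : monoidal_functor C) (X Y : C) :
  mf_map F (0 : hom X Y) = 0.
Proof. by apply: (addrI (mf_map F 0)); rewrite -mf_add !addr0. Qed.

Lemma mf_sum (F : monoidal_functor C) (I : finType) (X Y : C)
    (f : I -> hom X Y) :
  mf_map F (\sum_i f i) = \sum_i mf_map F (f i).
Proof. exact: (big_morph _ (@mf_add F X Y) (@mf_zero F X Y)). Qed.

End Category.

(** * Multiplication of the powers of g *)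

Section Powers.
Variables (k : fieldType) (C : braided_category k).
Variables (g : C) (M : nat) (q : k) (v : current_basis g M q).

Local Notation G i := (tpow g i).

(** The maps [v], with the target allowed to be any power whose exponent equals
the sum: the laws of [v] then hold without transports along equalities of
exponents.  The value 0 outside of that case is a junk value. *)
Definition mu (i j p : 'I_M) : hom (G i ⊗ G j) (G p) :=
  if addI i j =P p is ReflectT e
  then idcast (congr1 (fun i : 'I_M => G i) e) ∘ cb v i j else 0.

Lemma mu_cast i j p (e : addI i j = p) :
  mu i j p = idcast (congr1 (fun i : 'I_M => G i) e) ∘ cb v i j.
Proof. by rewrite /mu; case: eqP => // e'; rewrite (eq_irrelevance e' e). Qed.

Lemma muE i j : mu i j (addI i j) = cb v i j.
Proof. by rewrite (mu_cast erefl) comp1m. Qed.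

Lemma mu_assoc i j l ij jl ijl :
  addI i j = ij -> addI j l = jl -> addI i jl = ijl ->
  mu ij l ijl ∘ (mu i j ij ⊠ idm (G l)) =
  mu i jl ijl ∘ (idm (G i) ⊠ mu j l jl) ∘ assoc (G i) (G j) (G l).
Proof.
by move=> <- <- <-; rewrite !muE (mu_cast (addIA i j l)) cb_assoc.
Qed.

Lemma mu_assocV i j l ij jl ijl :
  addI i j = ij -> addI j l = jl -> addI i jl = ijl ->
  mu ij l ijl ∘ (mu i j ij ⊠ idm (G l)) ∘ assocV (G i) (G j) (G l) =
  mu i jl ijl ∘ (idm (G i) ⊠ mu j l jl).
Proof.
move=> e1 e2 e3; rewrite (mu_assoc e1 e2 e3) -compA assocVK.
by rewrite compm1.
Qed.

Lemma mu_braid i j p : addI i j = p ->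
  mu j i p ∘ braid (G i) (G j) = q ^+ (i * j) *: mu i j p.
Proof. by move=> <-; rewrite (mu_cast (addIC i j)) cb_braid muE. Qed.

Lemma mu_swap i j l jl p il : addI j l = jl -> addI i jl = p ->
  addI i l = il ->
  mu j il p ∘ (idm (G j) ⊠ mu i l il) ∘ swap (G i) (G j) (G l) =
  q ^+ (i * j) *: (mu i jl p ∘ (idm (G i) ⊠ mu j l jl)).
Proof.
move=> <- <- <-; have ji : addI j i = addI i j by rewrite addIC.
have jil : addI j (addI i l) = addI i (addI j l) by rewrite -!addIA ji.
rewrite swapE !compA -(mu_assoc ji (erefl _) jil) -!(compA (mu _ _ _)).
rewrite -tensm_comp1 mu_braid // tensmZl compZl compZr compA; congr (_ *: _).
by rewrite (mu_assocV erefl erefl).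
Qed.

(** Four powers of [g] can be multiplied in pairs in two ways; the middle two
factors trade places, and their braiding contributes the scalar.  This is the
only source of the twist acquired by the iterates of the functor. *)
Lemma mu_exchange i i' j j' ii' jj' ij ij' p :
  addI i i' = ii' -> addI j j' = jj' -> addI i j = ij -> addI i' j' = ij' ->
  addI ii' jj' = p ->
  mu ii' jj' p ∘ (mu i i' ii' ⊠ mu j j' jj')
    ∘ exchange (G i) (G j) (G i') (G j') =
  q ^+ (j * i') *: (mu ij ij' p ∘ (mu i j ij ⊠ mu i' j' ij')).
Proof.
move=> <- <- <- <- <-.
(* Rebracketing: multiply the four factors one after the other from the right. *)
have split2 (a b c d ab cd abcd bcd : 'I_M) :
    addI a b = ab -> addI c d = cd -> addI b cd = bcd -> addI a bcd = abcd ->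
    mu ab cd abcd ∘ (mu a b ab ⊠ mu c d cd) =
    mu a bcd abcd ∘ (idm (G a) ⊠ (mu b cd bcd ∘ (idm (G b) ⊠ mu c d cd)))
      ∘ assoc (G a) (G b) (G c ⊗ G d).
  move=> e1 e2 e3 e4; rewrite tensm_1comp compA -compA -assoc_nat tensm1 compA.
  by rewrite -(mu_assoc e1 e3 e4) -compA -tensm_comp compm1 comp1m.
have ij'j : addI i' (addI j j') = addI j (addI i' j').
  by rewrite -!addIA (addIC i').
have p1 : addI i (addI i' (addI j j')) = addI (addI i i') (addI j j').
  by rewrite addIA.
rewrite (split2 _ _ _ _ _ _ _ _ erefl erefl erefl p1).
rewrite exchangeE !compA -(compA _ (assoc _ _ _)) assocVK compm1.
rewrite -(compA (mu _ _ _)) -tensm_1comp.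
rewrite (mu_swap (jl := addI i' j')) // tensmZr compZr compZl; congr (_ *: _).
by rewrite (split2 _ _ _ _ _ _ _ _ erefl erefl erefl) // -ij'j.
Qed.

Lemma mu_iso i j p : has_tensor_order g M -> addI i j = p -> is_iso (mu i j p).
Proof.
move=> g_order <-; rewrite muE; apply: basis_iso; last exact: cb_basis.
exact: tpow_mod g_order (ltn_ord i) (ltn_ord j).
Qed.

Lemma mu_neq0 i j p : addI i j = p -> mu i j p != 0.
Proof.
move=> <-; rewrite muE; have /basis_free := cb_basis v i j.
by rewrite free_cons => /andP[+ _]; apply: contraNneq => ->; rewrite mem0v.
Qed.

Lemma mu_span (i j p : 'I_M) (f : hom (G i ⊗ G j) (G p)) :
  addI i j = p -> exists c, f = c *: mu i j p.
Proof.
move=> e; case: p / e f => f; rewrite muE; apply/vlineP.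
by rewrite -span_seq1 (span_basis (cb_basis v i j)) memvf.
Qed.

(** Braiding [g^i] with [g^j ⊗ g^l] and then multiplying, or multiplying first,
gives the same map by the hexagon and by naturality. *)
Lemma q_addI (i j l : 'I_M) : has_tensor_order g M ->
  q ^+ (i * addI j l) = q ^+ (i * j) * q ^+ (i * l).
Proof.
move=> g_order; set jl := addI j l; set p := addI i jl.
pose w := mu i jl p ∘ (idm (G i) ⊠ mu j l jl).
have w0 : w != 0.
  apply/eqP => w0; have /eqP[] := mu_neq0 (erefl p).
  apply: (iso_epi (iso_tensm (iso1 (G i)) (mu_iso g_order (erefl jl)))).
  by rewrite comp0l.
have jlp : addI jl i = p by rewrite addIC.
have lp : addI j (addI i l) = p by rewrite /p /jl -!addIA (addIC i).
have e : mu jl i p ∘ (braid (G i) (G jl) ∘ (idm (G i) ⊠ mu j l jl)) =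
    q ^+ (i * jl) *: w.
  by rewrite compA mu_braid // compZl.
suff : q ^+ (i * jl) *: w = (q ^+ (i * j) * q ^+ (i * l)) *: w.
  by move=> /eqP; rewrite -subr_eq0 -scalerBl scaler_eq0 (negPf w0) orbF
     subr_eq0 => /eqP.
have li : addI l i = addI i l by rewrite addIC.
rewrite -e braid_nat braid_tensr !compA (mu_assocV erefl li lp).
rewrite -(compA (mu _ _ _)) -tensm_1comp mu_braid // tensmZr compZr !compZl.
rewrite mulrC -scalerA -(mu_swap (erefl jl) (erefl p) (erefl (addI i l))).
by rewrite swapE !compA.
Qed.

End Powers.

(** * Functors that tensor homogeneous objects with powers of g *)

Section Presentation.
Variables (k : fieldType) (C : braided_category k).
Variables (g : C) (M : nat) (q z : k) (v : current_basis g M q).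
Hypothesis g_inv : invertible g.
Hypothesis g_order : has_tensor_order g M.
Hypothesis z_prim : M.-primitive_root z.
Variable D : homogeneous_decomposition g M z.

Local Notation G i := (tpow g i).

(** The structure map [tau], with the freedom in the target exponent of [mu]. *)
Definition tau_mu (i j p : 'I_M) (X Y : C) :
    hom ((G i ⊗ X) ⊗ (G j ⊗ Y)) (G p ⊗ (X ⊗ Y)) :=
  (mu v i j p ⊠ idm (X ⊗ Y)) ∘ exchange (G i) X (G j) Y.

Lemma tau_muE i j X Y : tau_mu i j (addI i j) X Y = tau v i j X Y.
Proof. by rewrite /tau_mu muE. Qed.

(** The maps [th] are asked to behave only on homogeneous objects: every object
is a sum of these, and both monoidal functors and natural transformations are
additive. *)
Definition presented (H : monoidal_functor C) (a : 'I_M -> 'I_M)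
    (chi : 'I_M -> 'I_M -> k) : Prop :=
  exists th : forall (m : 'I_M) (X : C), hom (G (a m) ⊗ X) (H X),
  [/\ forall (m : 'I_M) X, in_degree g z m X -> is_iso (th m X),
      forall (m : 'I_M) X Y (f : hom X Y), in_degree g z m X -> in_degree g z m Y ->
        mf_map H f ∘ th m X = th m Y ∘ (idm (G (a m)) ⊠ f)
    & forall (m n : 'I_M) X Y, in_degree g z m X -> in_degree g z n Y ->
        mf_tens H X Y ∘ (th m X ⊠ th n Y) =
        chi m n *: (th (addI m n) (X ⊗ Y)
                    ∘ tau_mu (a m) (a n) (a (addI m n)) X Y)].

Lemma inc_prj_degree (m : 'I_M) X : in_degree g z m X ->
  hinc D X m ∘ hprj D X m = idm X.
Proof. by move=> dX; rewrite -[hprj D X m]compm1 (degree_hom _ g_inv z_prim). Qed.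

Lemma mf_inc_prj (H : monoidal_functor C) X :
  \sum_m (mf_map H (hinc D X m) ∘ mf_map H (hprj D X m)) = idm (H X).
Proof.
rewrite -mf_id -(inc_prj D) mf_sum; apply: eq_bigr => m _.
by rewrite mf_comp.
Qed.

(** The only candidate for a comparison map [H X -> H' X] is the sum, over the
homogeneous components, of [th'] after the inverse of [th].  It intertwines [th]
with [th'] on all maps from a homogeneous object into [X], not only on the chosen
components, because a map out of an object of degree [m] meets the component
of degree [m] only. *)
Lemma presented_comparison (H H' : monoidal_functor C) (a : 'I_M -> 'I_M)
    (th : forall (m : 'I_M) (X : C), hom (G (a m) ⊗ X) (H X))
    (th' : forall (m : 'I_M) (X : C), hom (G (a m) ⊗ X) (H' X)) :
  (forall (m : 'I_M) X, in_degree g z m X -> is_iso (th m X)) ->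
  (forall (m : 'I_M) X Y (f : hom X Y), in_degree g z m X -> in_degree g z m Y ->
    mf_map H f ∘ th m X = th m Y ∘ (idm (G (a m)) ⊠ f)) ->
  (forall (m : 'I_M) X Y (f : hom X Y), in_degree g z m X -> in_degree g z m Y ->
    mf_map H' f ∘ th' m X = th' m Y ∘ (idm (G (a m)) ⊠ f)) ->
  exists eta : forall X, hom (H X) (H' X),
    forall (m : 'I_M) W X (h : hom W X), in_degree g z m W ->
      eta X ∘ (mf_map H h ∘ th m W) = mf_map H' h ∘ th' m W.
Proof.
move=> th_iso th_nat th'_nat.
pose thV m X := s2val (iso_inverse (th_iso m _ (hcomp_degree D X m))).
have thVK m X : thV m X ∘ th m (hcomp D X m) = idm _.
  exact: (s2valP (iso_inverse (th_iso m _ (hcomp_degree D X m)))).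
exists (fun X => \sum_m (mf_map H' (hinc D X m) ∘ th' m (hcomp D X m)
  ∘ thV m X ∘ mf_map H (hprj D X m))) => m W X h dW.
have dX := hcomp_degree D X m.
rewrite comp_suml (bigD1 m) //= big1 => [|n nm].
  rewrite addr0 -(compA _ (mf_map _ _)) (compA (mf_map _ _)) -mf_comp.
  rewrite th_nat // -(compA _ (thV m X)) (compA (thV m X)) thVK comp1m.
  rewrite -compA -th'_nat // compA -mf_comp.
  by rewrite (degree_hom _ g_inv z_prim).
rewrite -compA (compA (mf_map _ _)) -mf_comp.
rewrite (degree_hom0 _ g_inv z_prim _ dW) 1?eq_sym //.
by rewrite mf_zero comp0l comp0r.
Qed.

Lemma presented_epi (H : monoidal_functor C) (a : 'I_M -> 'I_M)
    (th : forall (m : 'I_M) (X : C), hom (G (a m) ⊗ X) (H X)) X Z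
    (u w : hom (H X) Z) :
  (forall (m : 'I_M) X, in_degree g z m X -> is_iso (th m X)) ->
  (forall m, u ∘ (mf_map H (hinc D X m) ∘ th m (hcomp D X m)) =
             w ∘ (mf_map H (hinc D X m) ∘ th m (hcomp D X m))) ->
  u = w.
Proof.
move=> th_iso e; rewrite -[u]compm1 -[w]compm1 -mf_inc_prj !comp_sumr.
apply: eq_bigr => m _; rewrite !compA; congr (_ ∘ _).
by apply: (iso_epi (th_iso m _ (hcomp_degree D X m))); rewrite -!compA.
Qed.

Lemma presented_epi2 (H : monoidal_functor C) (a : 'I_M -> 'I_M)
    (th : forall (m : 'I_M) (X : C), hom (G (a m) ⊗ X) (H X)) X Y Z
    (u w : hom (H X ⊗ H Y) Z) :
  (forall (m : 'I_M) X, in_degree g z m X -> is_iso (th m X)) ->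
  (forall m n,
    u ∘ ((mf_map H (hinc D X m) ∘ th m (hcomp D X m))
         ⊠ (mf_map H (hinc D Y n) ∘ th n (hcomp D Y n))) =
    w ∘ ((mf_map H (hinc D X m) ∘ th m (hcomp D X m))
         ⊠ (mf_map H (hinc D Y n) ∘ th n (hcomp D Y n)))) ->
  u = w.
Proof.
move=> th_iso e; rewrite -[u]compm1 -[w]compm1 -tensm1 -!mf_inc_prj.
rewrite tensm_suml !comp_sumr; apply: eq_bigr => m _.
rewrite tensm_sumr !comp_sumr; apply: eq_bigr => n _.
rewrite tensm_comp !compA; congr (_ ∘ _).
apply: (iso_epi (iso_tensm (th_iso m _ (hcomp_degree D X m))
                           (th_iso n _ (hcomp_degree D Y n)))).
by rewrite -!compA -tensm_comp.
Qed.

Lemma presented_unique (H H' : monoidal_functor C) (a : 'I_M -> 'I_M)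
    (chi : 'I_M -> 'I_M -> k) :
  presented H a chi -> presented H' a chi -> monoidally_isomorphic H H'.
Proof.
move=> [th [th_iso th_nat th_tens]] [th' [th'_iso th'_nat th'_tens]].
have [eta etaE] := presented_comparison th_iso th_nat th'_nat.
have [eta' eta'E] := presented_comparison th'_iso th'_nat th_nat.
exists eta; split=> [X|X Y f|X Y].
- exists (eta' X); split.
    apply: (presented_epi th_iso) => m; have dX := hcomp_degree D X m.
    by rewrite -compA etaE // eta'E // comp1m.
  apply: (presented_epi th'_iso) => m; have dX := hcomp_degree D X m.
  by rewrite -compA eta'E // etaE // comp1m.
- apply: (presented_epi th_iso) => m; have dX := hcomp_degree D X m.
  by rewrite -!compA etaE // !compA -!mf_comp -etaE // mf_comp !compA.
- apply: (presented_epi2 th_iso) => m n.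
  have [dX dY] := (hcomp_degree D X m, hcomp_degree D Y n).
  rewrite -!compA -!tensm_comp !etaE // !tensm_comp !compA.
  rewrite -(compA _ (mf_tens _ _ _)) !mf_tens_nat !compA.
  rewrite -(compA _ _ (th _ _ ⊠ _)) -(compA _ _ (th' _ _ ⊠ _)).
  rewrite th_tens // th'_tens // !compZr !compA -(compA _ _ (th _ _)).
  by rewrite etaE //; exact: degree_hcomp2.
Qed.

(** Rescaling the isomorphisms by a function of the degree changes the twist by
its coboundary. *)
Lemma presented_scale (H : monoidal_functor C) a chi (f : 'I_M -> k) :
  (forall m, f m != 0) -> presented H a chi ->
  presented H a (fun m n => f m * f n / f (addI m n) * chi m n).
Proof.
move=> f0 [th [th_iso th_nat th_tens]].
exists (fun m X => f m *: th m X); split=> [m X dX|m X Y h dX dY|m n X Y dX dY].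
- by apply: iso_scale; [exact: f0 | exact: th_iso].
- by rewrite compZr compZl th_nat.
- rewrite tensmZl tensmZr !compZr th_tens // compZl !scalerA; congr (_ *: _).
  by rewrite [in RHS]mulrAC mulfVK.
Qed.

(** Since [g^0] is the unit, the left unit constraint does the job once it is
normalised: [mu o o o] is only proportional to the unit constraint. *)
Lemma presented_one (o : 'I_M) : val o = 0%N ->
  presented (mf_one C) (fun=> o) (fun _ _ => 1).
Proof.
case: o => [[|//] lt0M] _ /=; set o := Ordinal lt0M.
have oo : addI o o = o by apply: val_inj; rewrite /= mod0n.
have [c lE] := mu_span v (lunit munit : hom (G o ⊗ G o) (G o)) oo.
have c0 : c != 0.
  apply: contraNneq (mu_neq0 v oo) => c0.
  by rewrite -[mu _ _ _ _]comp1m -(lunitVK munit) lE c0 scale0r !comp0l.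
exists (fun m X => c^-1 *: lunit X); split=> [m X _|m X Y f _ _|m n X Y _ _].
- by apply: iso_scale; [rewrite invr_eq0 | exact: iso_lunit].
- by rewrite /= compZr compZl lunit_nat.
- rewrite /= comp1m tensmZl tensmZr -exchange_unit lE scale1r.
  by rewrite tensmZl compZr !compZl !scalerA /tau_mu mulfVK // !compA.
Qed.

(** The heart of the composition: applying the structure maps of two successive
functors and then multiplying the two powers of [g] is, up to a scalar, the
same as multiplying these powers first and applying a single structure map. *)
Lemma tau_mu_interchange (m n p m' n' p' mm' nn' pp' : 'I_M) X Y :
  addI m n = p -> addI m' n' = p' ->
  addI m m' = mm' -> addI n n' = nn' -> addI p p' = pp' ->
  (mu v p p' pp' ⊠ idm (X ⊗ Y)) ∘ assocV (G p) (G p') (X ⊗ Y)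
    ∘ (idm (G p) ⊠ tau_mu m' n' p' X Y) ∘ tau_mu m n p (G m' ⊗ X) (G n' ⊗ Y)
    ∘ (assoc (G m) (G m') X ⊠ assoc (G n) (G n') Y) =
  q ^+ (m' * n) *: (tau_mu mm' nn' pp' X Y
    ∘ ((mu v m m' mm' ⊠ idm X) ⊠ (mu v n n' nn' ⊠ idm Y))).
Proof.
move=> e1 e2 e3 e4 e5.
have e : (idm (G p) ⊠ tau_mu m' n' p' X Y)
    ∘ tau_mu m n p (G m' ⊗ X) (G n' ⊗ Y) =
    (mu v m n p ⊠ (mu v m' n' p' ⊠ idm (X ⊗ Y)))
    ∘ ((idm (G m ⊗ G n) ⊠ exchange (G m') X (G n') Y)
       ∘ exchange (G m) (G m' ⊗ X) (G n) (G n' ⊗ Y)).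
  by rewrite /tau_mu (compA (idm _ ⊠ _)) (compA (mu _ _ _ _ ⊠ _))
             -!tensm_comp comp1m !compm1.
have ee := exchange_exchange (G m) (G m') X (G n) (G n') Y.
have en := exchange_nat (mu v m m' mm') (idm X) (mu v n n' nn') (idm Y).
have em := mu_exchange v e1 e2 e3 e4 e5.
rewrite -(compA _ (_ ⊠ tau_mu _ _ _ _ _)) e /tau_mu {e}.
(* Abstracting the exchanges keeps the rewriting from looking inside them. *)
move: (exchange (G m) (G m') _ _) (exchange (G m') X _ _)
  (exchange (G m) (G m' ⊗ X) _ _) (exchange (G mm') X _ _)
  (exchange (G m ⊗ G m') X _ _) ee en em => x1 x2 x3 x4 x5 ee en em.
rewrite -!compA (compE _ (assocV_nat _ _ _)) -!compA.
rewrite -!compA in ee; rewrite ee en !compA -!tensm_comp1 em.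
by rewrite tensmZl compZl tensm1 -tensm_comp1.
Qed.

(** The same interchange read backwards, for the isomorphisms that split
[g^(b m + a m) ⊗ X] into [g^(b m) ⊗ (g^(a m) ⊗ X)]. *)
Lemma fuse_powers (a b c : 'I_M -> 'I_M) :
  (forall m n, a (addI m n) = addI (a m) (a n)) ->
  (forall m n, b (addI m n) = addI (b m) (b n)) ->
  (forall m, c m = addI (b m) (a m)) ->
  exists ka : forall m X, hom (G (c m) ⊗ X) (G (b m) ⊗ (G (a m) ⊗ X)),
  [/\ forall m X, is_iso (ka m X),
      forall m X Y (f : hom X Y),
        (idm (G (b m)) ⊠ (idm (G (a m)) ⊠ f)) ∘ ka m X =
        ka m Y ∘ (idm (G (c m)) ⊠ f)
    & forall m n p X Y, p = addI m n ->
        (idm (G (b p)) ⊠ tau_mu (a m) (a n) (a p) X Y)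
          ∘ tau_mu (b m) (b n) (b p) (G (a m) ⊗ X) (G (a n) ⊗ Y)
          ∘ (ka m X ⊠ ka n Y) =
        q ^+ (a m * b n) *: (ka p (X ⊗ Y) ∘ tau_mu (c m) (c n) (c p) X Y)].
Proof.
move=> aD bD cE.
have c_iso m : is_iso (mu v (b m) (a m) (c m)) by apply: mu_iso; rewrite ?cE.
pose muV m := s2val (iso_inverse (c_iso m)).
have muVK m : muV m ∘ mu v (b m) (a m) (c m) = idm _.
  exact: (s2valP (iso_inverse (c_iso m))).
have muKV m : mu v (b m) (a m) (c m) ∘ muV m = idm _.
  exact: (s2valP' (iso_inverse (c_iso m))).
exists (fun m X => assoc (G (b m)) (G (a m)) X ∘ (muV m ⊠ idm X)).
split=> [m X|m X Y f|m n p X Y pE].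
- apply: isoM; first exact: iso_assoc.
  apply: iso_tensm; last exact: iso1.
  by exists (mu v (b m) (a m) (c m)).
- by rewrite compA -assoc_nat -!compA -!tensm_comp tensm1 !comp1m !compm1.
- have e1 : addI (b m) (b n) = b p by rewrite pE bD.
  have e2 : addI (a m) (a n) = a p by rewrite pE aD.
  have := tau_mu_interchange X Y e1 e2 (esym (cE m)) (esym (cE n)) (esym (cE p)).
  move: (tau_mu (a m) _ _ _ _) (tau_mu (b m) _ _ _ _) (tau_mu (c m) _ _ _ _).
  move=> ta tb tc /(congr1 (fun f => assoc _ _ _ ∘ (muV p ⊠ idm (X ⊗ Y)) ∘ f
    ∘ ((muV m ⊠ idm X) ⊠ (muV n ⊠ idm Y)))).
  rewrite !compZr compZl -!compA -!tensm_comp !muKV !comp1m !tensm1 compm1.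
  move=> <-; rewrite (compA (muV p ⊠ _)) -tensm_comp muVK comp1m.
  by rewrite tensm1 comp1m (compA (assoc _ _ _)) assocVK comp1m.
Qed.

(** The inner functor changes the degree: for [X] of degree [m], the object
[g^(a2 m) ⊗ X] has degree [b m = A * a2 m + m], and this is the degree in which
the outer functor has to be evaluated. *)
Lemma presented_compose (F H : monoidal_functor C) (A : nat)
    (a1 a2 b c : 'I_M -> 'I_M) chi1 chi2 :
  in_degree g z A g ->
  (forall m n, a1 (addI m n) = addI (a1 m) (a1 n)) ->
  (forall m n, a2 (addI m n) = addI (a2 m) (a2 n)) ->
  (forall m, val (b m) = (A * a2 m + m) %% M)%N ->
  (forall m, c m = addI (a1 (b m)) (a2 m)) ->
  presented F a1 chi1 -> presented H a2 chi2 ->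
  presented (mf_compose F H) c
    (fun m n => chi2 m n * chi1 (b m) (b n) * q ^+ (a2 m * a1 (b n))).
Proof.
move=> dg a1D a2D bE cE [ph [ph_iso ph_nat ph_tens]] [th [th_iso th_nat th_tens]].
have dGn n : in_degree g z (A * n) (tpow g n).
  elim: n => [|n IHn]; first by rewrite muln0; exact: in_degree_unit.
  by rewrite mulnSr; exact: in_degree_tens.
have dG (m : 'I_M) X :
    in_degree g z m X -> in_degree g z (b m) (G (a2 m) ⊗ X).
  move=> dX; rewrite [nat_of_ord (b m)]bE; apply: in_degree_mod => //.
  exact: in_degree_tens.
have bD m n : b (addI m n) = addI (b m) (b n).
  apply: val_inj; rewrite /= !bE a2D /= modnDm -modnDml modnMmr modnDml.
  by rewrite modnDmr mulnDr addnACA.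
have a1bD m n : a1 (b (addI m n)) = addI (a1 (b m)) (a1 (b n)).
  by rewrite bD a1D.
have [ka [ka_iso ka_nat ka_tau]] := fuse_powers a2D a1bD cE.
exists (fun m X => mf_map F (th m X) ∘ ph (b m) (G (a2 m) ⊗ X) ∘ ka m X).
split=> [m X dX|m X Y f dX dY|m n X Y dX dY].
- apply: isoM; [apply: isoM|exact: ka_iso].
    by apply: mf_iso; exact: th_iso.
  by apply: ph_iso; exact: dG.
- rewrite [mf_map (mf_compose F H) f]/= !compA -(mf_comp F) th_nat // mf_comp.
  rewrite -[RHS]compA -ka_nat !compA; congr (_ ∘ _).
  rewrite -!compA; congr (_ ∘ _).
  by rewrite ph_nat //; exact: dG.
- have dXY : in_degree g z (addI m n) (X ⊗ Y) by exact: degree_tens.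
  have dGXY : in_degree g z (b (addI m n)) ((G (a2 m) ⊗ X) ⊗ (G (a2 n) ⊗ Y)).
    by rewrite bD; apply: degree_tens => //; exact: dG.
  have scaleF U W x (f : hom U W) : mf_map F (x *: f) = x *: mf_map F f.
    by rewrite -[x *: f]addr0 mf_lin mf_zero addr0.
  have kt := ka_tau m n _ X Y erefl.
  have pt := ph_tens _ _ _ _ (dG _ _ dX) (dG _ _ dY).
  rewrite -bD in pt; have pn := ph_nat (b (addI m n)) _ _
    (tau_mu (a2 m) (a2 n) (a2 (addI m n)) X Y) dGXY (dG _ _ dXY).
  have tt := th_tens _ _ _ _ dX dY.
  move: (tau_mu (a2 m) _ _ _ _) (tau_mu (a1 (b m)) _ _ _ _)
    (tau_mu (c m) _ _ _ _) kt pt pn tt => t2 t1 tc kt pt pn tt.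
  rewrite [mf_tens (mf_compose F H) X Y]/= !tensm_comp -!compA.
  rewrite (compE _ (mf_tens_nat F _ _)) -!compA (compE _ pt).
  rewrite (compA (mf_map F _) (mf_map F _)) -(mf_comp F) tt scaleF !compZl.
  rewrite mf_comp !compZr -!compA (compE _ pn) -!compA (compA (_ ⊠ t2)) kt.
  by rewrite !compZr !scalerA !compA.
Qed.

Section Compose.
Variable S : direct_sums C M.

Local Notation F := (simple_current v g_inv g_order z_prim D S).
Local Notation summand X := (ext_summand D (fun i : 'I_M => tpow g i) X).

(** The functor is built on the chosen homogeneous components of its argument.
An [X] that is itself of degree [m] coincides with its component of degree [m],
whence an isomorphism of [g^m ⊗ X] with the image of [X]. *)
Definition homogeneous_image (m : 'I_M) (X : C) : hom (G m ⊗ X) (F X) :=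
  dinc S (summand X) m ∘ (idm (G m) ⊠ hprj D X m).

Lemma homogeneous_image_iso (m : 'I_M) X :
  in_degree g z m X -> is_iso (homogeneous_image m X).
Proof.
move=> dX; exists ((idm (G m) ⊠ hinc D X m) ∘ dprj S (summand X) m); split.
  rewrite /homogeneous_image -!compA (compA (dprj _ _ _)) pp_ii comp1m.
  rewrite -tensm_1comp.
  by rewrite inc_prj_degree // tensm1.
rewrite /homogeneous_image -!compA (compA (_ ⊠ _)) -tensm_1comp prj_inc.
rewrite tensm1 comp1m.
rewrite -(ii_pp D S) (bigD1 m) //= big1 ?addr0 // => n nm.
rewrite -[dinc _ _ n]compm1 -tensm1 -(prj_inc D).
have -> : hinc D X n = 0 by exact: hom_degree (hcomp_degree D X n) dX nm.
by rewrite comp0r tensm0r comp0r comp0l.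
Qed.

Lemma homogeneous_image_nat (m : 'I_M) X Y (f : hom X Y) :
  in_degree g z m X -> in_degree g z m Y ->
  mf_map F f ∘ homogeneous_image m X = homogeneous_image m Y ∘ (idm (G m) ⊠ f).
Proof.
move=> dX dY; rewrite /homogeneous_image compA /= map_inc.
rewrite -!compA -!tensm_1comp -!compA.
by rewrite inc_prj_degree // compm1.
Qed.

Lemma homogeneous_image_tens (m n : 'I_M) X Y :
  in_degree g z m X -> in_degree g z n Y ->
  mf_tens F X Y ∘ (homogeneous_image m X ⊠ homogeneous_image n Y) =
  homogeneous_image (addI m n) (X ⊗ Y) ∘ tau_mu m n (addI m n) X Y.
Proof.
move=> dX dY; rewrite tau_muE /homogeneous_image tensm_comp compA /= tens_inc.
rewrite -(compA _ (tau _ _ _ _ _)) tau_nat !compA.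
rewrite -!(compA (dinc _ _ _)) -!tensm_1comp -!compA.
by rewrite -tensm_comp !inc_prj_degree // tensm1 compm1.
Qed.

Lemma presented_simple_current :
  presented F id (fun _ _ => 1).
Proof.
exists homogeneous_image; split;
  [exact: homogeneous_image_iso | exact: homogeneous_image_nat |].
by move=> m n X Y dX dY; rewrite scale1r homogeneous_image_tens.
Qed.

End Compose.
End Presentation.

(** * Scalars and exponents modulo M *)

Definition mulI (M e : nat) (m : 'I_M) : 'I_M :=
  Ordinal (ltn_pmod (e * m) (leq_ltn_trans (leq0n m) (ltn_ord m))).

Lemma mulI_addr M e (m n : 'I_M) :
  mulI e (addI m n) = addI (mulI e m) (mulI e n).
Proof. by apply: val_inj; rewrite /= modnMmr modnDm mulnDr. Qed.

Lemma bin2D m n : ('C(m + n, 2) = 'C(m, 2) + 'C(n, 2) + m * n)%N.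
Proof.
elim: n => [|n IHn]; first by rewrite addn0 muln0 !addn0.
by rewrite addnS !binS IHn !bin1 mulnS; ring.
Qed.

(** The function [m |-> x ^+ 'C(m, 2)] satisfies the equation on the natural
numbers.  It need not be periodic, but going from [m] to [m + M] multiplies it
by a constant only, which an [M]-th root [u] compensates. *)
Lemma quadratic_refinement (k : fieldType) (M : nat) (x : k) :
  (0 < M)%N -> x ^+ M = 1 -> (forall y : k, exists u, u ^+ M = y) ->
  exists2 f : 'I_M -> k, forall m, f m != 0
    & forall m n, f (addI m n) = f m * f n * x ^+ (m * n).
Proof.
move=> M0 xM roots; have [u uM] := roots (x ^- 'C(M, 2)).
have x0 : x != 0.
  by apply: contra_eq_neq xM => ->; rewrite expr0n gtn_eqF // eq_sym oner_neq0.
have u0 : u != 0.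
  apply: contra_eq_neq uM => ->; rewrite expr0n gtn_eqF //.
  by rewrite eq_sym invr_neq0 // expf_neq0.
pose F m := u ^+ m * x ^+ 'C(m, 2).
have FD m n : F (m + n)%N = F m * F n * x ^+ (m * n).
  by rewrite /F bin2D !exprD; ring.
have FM m : F (m + M)%N = F m.
  rewrite FD [F M]/F uM mulVf ?expf_neq0 // mulr1 mulnC exprM xM expr1n.
  by rewrite mulr1.
have Fmod m : F (m %% M)%N = F m.
  rewrite [in RHS](divn_eq m M) addnC; elim: (m %/ M)%N => [|i IHi].
    by rewrite addn0.
  by rewrite mulSnr addnA FM.
exists (fun m => F m) => [m|m n]; first by rewrite mulf_neq0 ?expf_neq0.
by rewrite Fmod FD.
Qed.

(** * The iterates of the simple current auto-equivalence *)

Section Iterate.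
Variables (k : fieldType) (C : braided_category k).
Variables (g : C) (M : nat) (q z : k) (v : current_basis g M q).
Hypothesis g_inv : invertible g.
Hypothesis g_order : has_tensor_order g M.
Hypothesis z_prim : M.-primitive_root z.
Variables (D : homogeneous_decomposition g M z) (S : direct_sums C M).

Local Notation F := (simple_current v g_inv g_order z_prim D S).

(** The relation [q ^+ M = 1] follows from [q_addI] for the exponents
[1 + (M - 1) = 0], provided that 1 is one of the exponents.  For [M = 1] the
scalar [q] does not occur in the laws of [v], and it is replaced by 1. *)
Lemma q_root : exists2 r : k, r ^+ M = 1
  & forall i j : 'I_M, q ^+ (i * j) = r ^+ (i * j).
Proof.
have M0 := prim_order_gt0 z_prim; have [M1|M1] := leqP M 1.
  exists 1 => [|i j]; first by rewrite expr1n.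
  have -> : i = 0%N :> nat by have := ltn_ord i; lia.
  by rewrite mul0n !expr0.
exists q => //; have M1' : (M.-1 < M)%N by rewrite ltn_predL.
have := q_addI v (Ordinal M1) (Ordinal M1') (Ordinal M1) g_order.
by rewrite /= !mul1n addn1 prednK // modnn expr0 -exprSr prednK.
Qed.

Lemma presented_iter (A K : nat) :
  in_degree g z A g ->
  exists e x, [/\ (A * e + 1 = (A + 1) ^ K)%N, x ^+ M = 1
    & presented z v (mf_iter K F) (mulI e) (fun m n => x ^+ (m * n))].
Proof.
move=> dg; have [r rM qr] := q_root; have M0 := prim_order_gt0 z_prim.
elim: K => [|K [e [x [eE xM pK]]]].
  exists 0%N, 1; split; rewrite ?expr1n ?muln0 //=.
  have -> : @mulI M 0 = (fun=> Ordinal M0).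
    by apply/funext => m; apply: val_inj; rewrite /= mul0n mod0n.
  under [X in presented _ _ _ _ X]eq_fun do under eq_fun do rewrite expr1n.
  exact: presented_one.
pose b := @mulI M (A * e + 1).
exists (A * e + 1 + e)%N, (x * r ^+ (e * (A * e + 1))); split.
- by rewrite expnS -eE; ring.
- by rewrite exprMn xM -exprM mulnC exprM rM expr1n mulr1.
have -> : (fun m n : 'I_M => (x * r ^+ (e * (A * e + 1))) ^+ (m * n)) =
    (fun m n : 'I_M => x ^+ (m * n) * 1 * q ^+ (mulI e m * b n)).
  apply/funext => m; apply/funext => n; rewrite mulr1 exprMn qr; congr (_ * _).
  rewrite [RHS]exprM expr_mod; last by rewrite -exprM mulnC exprM rM expr1n.
  rewrite -exprM mulnC [RHS]exprM expr_mod //.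
  by rewrite -!exprM; congr (_ ^+ _); ring.
apply: (presented_compose (b := b) g_order z_prim dg _ (mulI_addr e) _ _
  (presented_simple_current v g_inv g_order z_prim D S) pK) => //.
- by move=> m; rewrite /= -[RHS]modnDml modnMmr modnDml mulnDl mul1n mulnA.
- by move=> m; apply: val_inj; rewrite /= modnDm mulnDl.
Qed.

End Iterate.

Theorem proposition3p9 (R : realType) (C : modular_category R[i])
    (g : C) (M : nat) (q zeta : R[i]) (d A K : nat)
    (g_inv : invertible g)
    (g_order : has_tensor_order g M)
    (q_def : braid g g = q *: idm (g ⊗ g))
    (d_def : d.-primitive_root (q ^+ 2))
    (A_def : A = (M %/ d)%N)
    (A_coprime : coprime (A + 1) M)
    (zeta_prim : M.-primitive_root zeta)
    (zeta_pow : zeta ^+ A = q ^+ 2)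
    (v : current_basis g M q)
    (D : homogeneous_decomposition g M zeta)
    (S : direct_sums C M)
    (K_gt0 : (0 < K)%N)
    (K_pow : ((A + 1) ^ K = 1 %[mod A * M])%N) :
  monoidally_isomorphic
    (mf_iter K (simple_current v g_inv g_order zeta_prim D S))
    (mf_one C).
Proof.
have M0 := prim_order_gt0 zeta_prim.
have A0 : (0 < A)%N.
  have dM : (d %| M)%N.
    rewrite (prim_order_dvd d_def) -zeta_pow -exprM mulnC exprM.
    by rewrite (prim_expr_order zeta_prim) expr1n.
  by rewrite A_def divn_gt0 ?(prim_order_gt0 d_def) // dvdn_leq.
have dg : in_degree g zeta A g.
  by rewrite /in_degree q_def compZl compZr comp1m scalerA -expr2 zeta_pow.
have [e [x [eE xM pK]]] := presented_iter v g_inv g_order zeta_prim D S K dg.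
have Me : (M %| e)%N.
  rewrite -(dvdn_pmul2l A0); move/eqP: K_pow; rewrite -eE eqn_mod_dvd ?leq_addl //.
  by rewrite addnK.
have [f f0 fD] := quadratic_refinement M0 xM
  (fun y : R[i] => ex_intro _ _ (rootCK M0 y)).
apply: (presented_unique g_inv zeta_prim D);
  last exact: (presented_one zeta v (o := Ordinal M0)).
have := presented_scale f0 pK.
have -> : mulI e = (fun=> Ordinal M0).
  apply/funext => m; apply: val_inj; apply/eqP.
  by rewrite /= -/(dvdn _ _) dvdn_mulr.
have -> // : (fun m n => f m * f n / f (addI m n) * x ^+ (m * n)) = fun _ _ => 1.
apply/funext => m; apply/funext => n.
by rewrite mulrAC -fD mulfV.
Qed.
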